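(* Let $(R,\mathfrak m)$ be a Cohen-Macaulay local ring of dimension $d\geq 1$ with infinite residue field, let $I_1,\ldots,I_s$ be $\mathfrak m$-primary ideals of $R$ and let $\mathcal F=\{\mathcal F(\underline n)\}_{\underline n\in\mathbb Z^s}$ be an $\underline I$-admissible filtration of ideals in $R$. Let $\mathcal A=\{x_{ij}\in I_i: j=1,\ldots,d;\ i=1,\ldots,s\}$ be any complete reduction of $\mathcal F$, let $y_j=x_{1j}\cdots x_{sj}$ for $j=1,\ldots,d$, let $\underline y=y_1,\ldots,y_d$ and $J=(\underline y)$. Then for all $\underline n\in\mathbb Z^s$, $$\Delta^d\big(P_{\mathcal F}(\underline n)-H_{\mathcal F}(\underline n)\big)=\lambda\left(\frac{\mathcal F(\underline n+de)}{J\mathcal F(\underline n+(d-1)e)}\right)-\sum_{i=2}^{d}(-1)^i\lambda\big(H_i(C_\bullet(\underline y,\mathcal F(\underline n)))\big).$$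
   Context: Notation: $\mathbb N=\{0,1,2,\ldots\}$, $\lambda$ denotes length over $R$, $s\ge 1$, $e=(1,\ldots,1)\in\mathbb Z^s$; $\underline n\ge\underline m$ means componentwise inequality; $\underline n^+=(\max(n_1,0),\ldots,\max(n_s,0))$; $|\alpha|=\alpha_1+\cdots+\alpha_s$; $\underline I=(I_1,\ldots,I_s)$ and $\underline I^{\underline n}=I_1^{n_1}\cdots I_s^{n_s}$, where a nonpositive power of an ideal is $R$. ''For all large $\underline n$'' means for all $\underline n\in\mathbb N^s$ with every $n_i\gg0$. Filtrations: a $\mathbb Z^s$-graded $\underline I$-filtration is a family of ideals $\mathcal F=\{\mathcal F(\underline n)\}_{\underline n\in\mathbb Z^s}$ of $R$ with $\underline I^{\underline n}\subseteq\mathcal F(\underline n)$, $\mathcal F(\underline n)\mathcal F(\underline m)\subseteq\mathcal F(\underline n+\underline m)$, and $\mathcal F(\underline m)\subseteq\mathcal F(\underline n)$ whenever $\underline m\geq\underline n$. It is $\underline I$-admissible if moreover $\mathcal F(\underline n)=\mathcal F(\underline n^+)$ for all $\underline n$ and $\mathcal R'(\mathcal F)=\bigoplus_{\underline n\in\mathbb Z^s}\mathcal F(\underline n)\underline t^{\underline n}$ is a finite module over $\mathcal R'(\underline I)=\bigoplus_{\underline n\in\mathbb Z^s}\underline I^{\underline n}\underline t^{\underline n}$, where $t_1,\dots,t_s$ are indeterminates and $\underline t^{\underline n}=t_1^{n_1}\cdots t_s^{n_s}$. Hilbert function and polynomial: $H_{\mathcal F}(\underline n)=\lambda(R/\mathcal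 F(\underline n))$, and $P_{\mathcal F}$ is the unique polynomial (of degree $d$) with $P_{\mathcal F}(\underline n)=H_{\mathcal F}(\underline n)$ for all large $\underline n$. Differences: for $f:\mathbb Z^s\to\mathbb Z$, $\Delta^1(f(\underline n))=f(\underline n+e)-f(\underline n)$ and $\Delta^k(f(\underline n))=\Delta^{k-1}(\Delta^1(f(\underline n)))$ for $k\ge2$. Complete reduction: a set $\mathcal A=\{x_{ij}\in I_i: j=1,\ldots,d;\ i=1,\ldots,s\}$ is a complete reduction of $\mathcal F$ if, with $y_j=x_{1j}\cdots x_{sj}$ and $J=(y_1,\ldots,y_d)$, one has $J\mathcal F(\underline n)=\mathcal F(\underline n+e)$ for all large $\underline n\in\mathbb N^s$. Complex: the degree $\underline n$ component of the Koszul complex of $\mathcal R'(\mathcal F)$ on $y_1\underline t^{e},\ldots,y_d\underline t^{e}$ is a subcomplex of the Koszul complex $K_\bullet(\underline y,R)$ of the form $$0\to\mathcal F(\underline n)\to\mathcal F(\underline n+e)^{\binom d1}\to\cdots\to\mathcal F(\underline n+(d-1)e)^{\binom d{d-1}}\to\mathcal F(\underline n+de)\to0 .$$ $C_\bullet(\underline y,\mathcal F(\underline n))$ is the quotient complex $$0\to \frac{R}{\mathcal F(\underline n)}\to\left(\frac{R}{\mathcal F(\underline n+e)}\right)^{\binom d1}\to\cdots\to\left(\frac{R}{\mathcal F(\underline n+(d-1)e)}\right)^{\binom d{d-1}}\to\frac{R}{\mathcal F(\underline n+de)}\to0,$$ with Koszul differentials; the term $R/\mathcal F(\underline n)$ is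 in homological degree $d$ and $R/\mathcal F(\underline n+de)$ is in homological degree $0$. $H_i$ denotes its $i$-th homology. *)

(* Defs.v *)
From mathcomp Require Export all_boot all_order all_algebra.
From mathcomp Require Export boolp classical_sets functions cardinality fsbigop.
From mathcomp Require Export mpoly.

Set Implicit Arguments.
Unset Strict Implicit.
Unset Printing Implicit Defensive.

Import Order.TTheory GRing.Theory Num.Theory.

Local Open Scope classical_set_scope.
Local Open Scope ring_scope.

Section Chains.
Variable T : Type.

Definition has_chain (C : set (set T)) (l : nat) : Prop :=
  exists L : nat -> set T,
    (forall i, (i <= l)%N -> C (L i)) /\
    (forall i, (i < l)%N -> L i `<` L i.+1).

Definition chain_height (C : set (set T)) (l : nat) : Prop :=
  has_chain C l /\ forall k, has_chain C k -> (k <= l)%N.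

End Chains.

Section Modules.
Variables (R : comNzRingType) (V : lmodType R).
Implicit Types M N W : set V.

Definition submodule W : Prop :=
  W 0 /\ forall (a : R) (u v : V), W u -> W v -> W (a *: u + v).

(* The length of N / M for submodules M <= N of V, as the supremum of the
   lengths of strict chains of submodules of N / M; these are the submodules
   of V lying between M and N.  The junk value 0 is taken when the supremum is
   infinite or when M is not contained in N. *)
Definition length (N M : set V) : nat :=
  xget 0%N [set l | chain_height
                      [set W | [/\ submodule W, M `<=` W & W `<=` N]] l].

End Modules.

Section Ideals.
Variable R : comNzRingType.
Implicit Types A B P Q m : set R.

Definition ideal A : Prop := @submodule R R^o A.

Definition ideal_gen (X : set R) : set R := smallest ideal X.

Definition ideal_mul A B : set R := ideal_gen [set a * b | a in A & b in B].

Definition ideal_pow A (k : nat) : set R := iter k (ideal_mul A) setT.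

Definition noetherian : Prop :=
  forall A, ideal A -> exists k (g : 'I_k -> R), A = ideal_gen (range g).

Definition prime_ideal P : Prop :=
  [/\ ideal P, ~ P 1 & forall x y, P (x * y) -> P x \/ P y].

Definition maximal_ideal m : Prop :=
  [/\ ideal m, ~ m 1 &
      forall A, ideal A -> m `<=` A -> ~ A 1 -> A = m].

Definition local_ring m : Prop :=
  maximal_ideal m /\ forall m', maximal_ideal m' -> m' = m.

Definition krull_dim (d : nat) : Prop := chain_height prime_ideal d.

Definition radical A : set R := [set x | exists k : nat, A (x ^+ k)].

Definition primary_ideal Q : Prop :=
  [/\ ideal Q, ~ Q 1 & forall x y, Q (x * y) -> Q x \/ radical Q y].

Definition m_primary m Q : Prop := primary_ideal Q /\ radical Q = m.

Definition infinite_residue_field m : Prop :=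
  infinite_set (range (fun x : R => [set x + u | u in m])).

Definition regular_seq (x : seq R) : Prop :=
  ~ ideal_gen [set` x] 1 /\
  forall i a, (i < size x)%N ->
    ideal_gen [set` take i x] (x`_i * a) -> ideal_gen [set` take i x] a.

Definition depth m (k : nat) : Prop :=
  (exists x : seq R, [/\ [set` x] `<=` m, regular_seq x & size x = k]) /\
  forall x : seq R, [set` x] `<=` m -> regular_seq x -> (size x <= k)%N.

Definition cohen_macaulay_local m : Prop :=
  [/\ noetherian, local_ring m & exists k, krull_dim k /\ depth m k].

End Ideals.

Section Filtrations.
Variables (R : comNzRingType) (s : nat).
Implicit Types (n : 'rV[int]_s) (F G : 'rV[int]_s -> set R).
Implicit Types I : 'I_s -> set R.

Definition evec : 'rV[int]_s := const_mx 1.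

Definition mge (n k : 'rV[int]_s) : Prop := forall i, k 0 i <= n 0 i.

Definition pos_part n : 'rV[int]_s := \row_i Num.max (n 0 i) 0.

Definition for_large (P : 'rV[int]_s -> Prop) : Prop :=
  exists N : nat, forall n, (forall i, N%:Z <= n 0 i) -> P n.

Definition ideal_mpow I n : set R :=
  \big[@ideal_mul R/setT]_(i < s) ideal_pow (I i) (absz (pos_part n 0 i)).

Definition filtration I F : Prop :=
  [/\ forall n, ideal (F n),
      forall n, ideal_mpow I n `<=` F n,
      forall n k, ideal_mul (F n) (F k) `<=` F (n + k) &
      forall n k, mge k n -> F k `<=` F n].

(* Laurent polynomials in t_1, ..., t_s over R are represented by their
   coefficient functions 'rV[int]_s -> R with finite support; [rees G] is then
   the direct sum of the G(n) t^n. *)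
Definition rees G : set ('rV[int]_s -> R) :=
  [set f | finite_set [set n | f n <> 0] /\ forall n, G n (f n)].

Definition laurent_mul (f g : 'rV[int]_s -> R) : 'rV[int]_s -> R :=
  fun n => \sum_(k \in [set: 'rV[int]_s]) f k * g (n - k).

Definition rees_finite I F : Prop :=
  exists r (g : 'I_r -> 'rV[int]_s -> R),
    (forall j, rees F (g j)) /\
    forall f, rees F f ->
      exists a : 'I_r -> 'rV[int]_s -> R,
        (forall j, rees (ideal_mpow I) (a j)) /\
        forall n, f n = \sum_(j < r) laurent_mul (a j) (g j) n.

Definition admissible I F : Prop :=
  [/\ filtration I F, forall n, F n = F (pos_part n) & rees_finite I F].

Definition hilbert_fun F n : nat := length (V := R^o) setT (F n).

(* Agreement with the Hilbert function for all large n determines the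
   polynomial, hence its degree, which is therefore not prescribed. *)
Definition hilbert_poly F (P : {mpoly rat[s]}) : Prop :=
  for_large (fun n => P.@[fun i => (n 0 i)%:~R] = (hilbert_fun F n)%:R).

Definition delta1 (A : zmodType) (f : 'rV[int]_s -> A) : 'rV[int]_s -> A :=
  fun n => f (n + evec) - f n.

Definition delta (A : zmodType) (k : nat) (f : 'rV[int]_s -> A) :
    'rV[int]_s -> A :=
  iter k (@delta1 A) f.

Definition yprod d (x : 'I_s -> 'I_d -> R) (j : 'I_d) : R := \prod_(i < s) x i j.

Definition complete_reduction I F d (x : 'I_s -> 'I_d -> R) : Prop :=
  (forall i j, I i (x i j)) /\
  for_large (fun n =>
    ideal_mul (ideal_gen (range (yprod x))) (F n) = F (n + evec)).

End Filtrations.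

Section KoszulComplex.
Variables (R : comNzRingType) (s d : nat).
Variables (y : 'I_d -> R) (F : 'rV[int]_s -> set R).

(* The exterior algebra on R^d: z S is the coefficient of the basis element
   e_S = e_(j_1) /\ ... /\ e_(j_i), where S = {j_1 < ... < j_i}. *)
Definition exterior : lmodType R := {ffun {set 'I_d} -> R^o}.

Definition koszul_deg (i : nat) : set exterior :=
  [set z : exterior | forall S : {set 'I_d}, #|S| <> i -> z S = 0].

(* e_(j_1) /\ ... /\ e_(j_i) is sent to the sum over r of
   (-1)^(r-1) y_(j_r) e_(j_1) /\ ... (omit e_(j_r)) ... /\ e_(j_i). *)
Definition koszul_diff (z : exterior) : exterior :=
  [ffun T : {set 'I_d} =>
     \sum_(j < d | j \notin T)
       (-1) ^+ #|[pred k in T | (k < j)%N]| * y j * z (j |: T)%SET].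

Definition koszul_sub (n : 'rV[int]_s) (i : nat) : set exterior :=
  [set z : exterior | koszul_deg i z /\
     forall S, F (n + evec s *+ (d - i)) (z S)].

(* C_i(y, F(n)) is koszul_deg i / koszul_sub n i, for 0 <= i <= d, with the
   induced differential.  Its elements are represented by elements of
   koszul_deg i: representatives of cycles are those z whose differential
   vanishes modulo koszul_sub n i.-1 (the condition is void for i = 0, as
   koszul_diff is 0 on koszul_deg 0), and representatives of boundaries are
   those equal to a differential modulo koszul_sub n i. *)
Definition quot_cycles (n : 'rV[int]_s) (i : nat) : set exterior :=
  [set z : exterior | koszul_deg i z /\ koszul_sub n i.-1 (koszul_diff z)].

Definition quot_boundaries (n : 'rV[int]_s) (i : nat) : set exterior :=
  [set koszul_diff w + u | w in koszul_deg i.+1 & u in koszul_sub n i].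

Definition length_quot_homology (n : 'rV[int]_s) (i : nat) : nat :=
  length (quot_cycles n i) (quot_boundaries n i).

End KoszulComplex.

(* Main.v *)
Require Import Defs.
From mathcomp Require Import ring lra zify.

Set Implicit Arguments.
Unset Strict Implicit.
Unset Printing Implicit Defensive.

Import Order.TTheory GRing.Theory Num.Theory.

Local Open Scope classical_set_scope.
Local Open Scope ring_scope.

(** Write [H_i] for the homology of the quotient complex
    [C(y, F(n))]. Three facts give the formula.

    Since the term of degree [i] of [C(y, F(n))] has length
    [binomial(d, i) * H_F(n + (d - i) e)], additivity of length turns
    [Delta^d H_F (n)] into the Euler characteristic [\sum_i (-1)^i length(H_i)]
    ([euler_characteristic]).

    A depth argument shows that the Koszul complex [K(y, R)] has no homology in
    positive degrees: [R] has a regular sequence [x_1, ..., x_d] in the maximal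
    ideal, as long as [y], and every [x_t] is nilpotent modulo [J = (y)]
    ([koszul_acyclic]). This determines the two lowest terms of the Euler
    characteristic: [H_0 = R / (J + F(n + d e))], while the differential embeds
    [H_1] into [F(n + d e) / J F(n + (d - 1) e)], with image
    [(J \cap F(n + d e)) / J F(n + (d - 1) e)]. Hence
    [length(H_0) - length(H_1) =
     length(R / J) - length(F(n + d e) / J F(n + (d - 1) e))]
    ([length_low_homology]).

    It remains to see that [Delta^d P_F = length(R / J)] everywhere
    ([delta_hilbert_poly]). Acyclicity also holds for the powers
    [y_1^(c_1), ..., y_d^(c_d)], and it makes each [J^k / J^(k + 1)] free over
    [R / J] on the monomials of degree [k]; so [length(R / J^k)] is
    [length(R / J)] times a binomial coefficient of degree [d] in [k]
    ([has_length_ideal_pow]). Along a diagonal, for [k] large,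
    [F(n + k e) = J^(k - l) G] with [G] containing a power of [J]; thus
    [P_F(n + k e)] is squeezed between two translates of [length(R / J^k)],
    and a polynomial so squeezed has the same [d]-th difference
    ([squeeze_diff]). *)

(** * Lengths as heights of intervals of submodules *)

Section ChainHeight.
Variables (T T' : Type).

Lemma has_chain_homo (C : set (set T)) (C' : set (set T'))
    (g : set T -> set T') l :
  (forall W, C W -> C' (g W)) ->
  (forall W W', C W -> C W' -> W `<` W' -> g W `<` g W') ->
  has_chain C l -> has_chain C' l.
Proof.
move=> gC gP [L [LC Ls]]; exists (g \o L); split=> i il /=; first exact/gC/LC.
by apply: gP (Ls _ il); apply: LC => //; apply: ltnW.
Qed.

(** Deleting the repetitions of a weakly increasing sequence leaves a strict
    chain. *)
Lemma has_chain_steps (C : set (set T)) (L : nat -> set T) l :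
  (forall i, (i <= l)%N -> C (L i)) ->
  (forall i, (i < l)%N -> L i `<=` L i.+1) ->
  has_chain C (\sum_(i < l) `[< L i `<` L i.+1 >])%N.
Proof.
move=> LC Lle; set c := fun l => (\sum_(i < l) `[< L i `<` L i.+1 >])%N.
suff [K [KC Ks _]] : exists K : nat -> set T,
    [/\ forall i, (i <= c l)%N -> C (K i),
        forall i, (i < c l)%N -> K i `<` K i.+1 & K (c l) = L l].
  by exists K.
elim: l LC Lle => [|l IH] LC Lle.
  by exists L; rewrite /c big_ord0; split=> // i;
    rewrite leqn0 => /eqP->; apply: LC.
have [||K [KC Ks Kl]] := IH.
- by move=> i il; apply: LC; apply: leqW.
- by move=> i il; apply: Lle; apply: leqW.
rewrite /c big_ord_recr /= -/(c l); case: asboolP => [lt|nlt]; last first.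
  rewrite addn0; exists K; split=> //; rewrite Kl.
  have le := Lle l (ltnSn _).
  apply/seteqP; split=> //; apply: contrapT => nle; exact: nlt.
rewrite addn1; exists (fun i => if (i <= c l)%N then K i else L l.+1); split.
- by move=> i il; case: leqP => [/KC//|_]; apply: LC.
- move=> i; rewrite ltnS => il; rewrite il; move: il.
  rewrite leq_eqVlt => /orP[/eqP->|il]; last by rewrite il; apply: Ks.
  by rewrite ltnn Kl.
- by rewrite ltnn.
Qed.

Lemma chain_height_uniq (C : set (set T)) k l :
  chain_height C k -> chain_height C l -> k = l.
Proof. by move=> [a b] [c e]; apply/eqP; rewrite eqn_leq e ?b. Qed.

Lemma chain_height_bounded (C : set (set T)) b :
  C !=set0 -> (forall k, has_chain C k -> (k <= b)%N) ->
  exists l, chain_height C l.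
Proof.
move=> [W CW] bC.
have ex : exists k, `[< has_chain C k >].
  by exists 0%N; apply/asboolP; exists (fun=> W); split.
have ub k : `[< has_chain C k >] -> (k <= b)%N by move/asboolP/bC.
exists (ex_maxn ex ub); case: ex_maxnP => k /asboolP kC kmax; split=> // k' /asboolP.
exact: kmax.
Qed.

End ChainHeight.

Section Length.
Variables (R : comNzRingType).
Implicit Types (V U : lmodType R).

Definition interval V (N M : set V) : set (set V) :=
  [set W | [/\ submodule W, M `<=` W & W `<=` N]].

(** The function [length] takes the value 0 on infinite lengths; the relation
    below carries the finiteness with it, so that lengths can be added without
    separate finiteness conditions. *)
Definition has_length V (N M : set V) l := chain_height (interval N M) l.

Definition finite_length V (N M : set V) := exists l, has_length N M l.

Lemma lengthE V (N M : set V) l : has_length N M l -> length N M = l.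
Proof.
move=> h; rewrite /length; case: xgetP => [k _ hk|/(_ l)//].
exact: chain_height_uniq hk h.
Qed.

Lemma finite_lengthP V (N M : set V) :
  finite_length N M -> has_length N M (length N M).
Proof. by case=> l h; rewrite (lengthE h). Qed.

Section Submodules.
Variables (V : lmodType R) (W : set V).
Hypothesis hW : submodule W.

Lemma submod0 : W 0. Proof. by case: hW. Qed.

Lemma submodD u v : W u -> W v -> W (u + v).
Proof. by move=> a b; rewrite -[u]scale1r; apply hW. Qed.

Lemma submodZ a u : W u -> W (a *: u).
Proof. by move=> h; rewrite -[_ *: _]addr0; apply hW => //; apply: submod0. Qed.

Lemma submodN u : W u -> W (- u).
Proof. by move=> h; rewrite -scaleN1r; apply: submodZ. Qed.

Lemma submodB u v : W u -> W v -> W (u - v).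
Proof. by move=> a b; apply: submodD => //; apply: submodN. Qed.

Lemma submod_sum (I : Type) (r : seq I) (P : pred I) (f : I -> V) :
  (forall i, P i -> W (f i)) -> W (\sum_(i <- r | P i) f i).
Proof. by move=> h; apply: (big_ind W) => //; [apply: submod0|apply: submodD]. Qed.

End Submodules.

Lemma submodule_setT V : submodule [set: V].
Proof. by []. Qed.

Lemma submoduleI V (M N : set V) :
  submodule M -> submodule N -> submodule (M `&` N).
Proof.
move=> hM hN; split=> [|a u v [? ?] [? ?]]; first by split; exact: submod0.
by split; [apply hM|apply hN].
Qed.

Definition sum_sub V (M N : set V) : set V := [set u + v | u in M & v in N].

Lemma submodule_sum V (M N : set V) :
  submodule M -> submodule N -> submodule (sum_sub M N).
Proof.
move=> hM hN; split=> [|a _ _ [u Mu [v Nv <-]] [u' Mu' [v' Nv' <-]]].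
  by exists 0; [exact: submod0|exists 0; [exact: submod0|rewrite addr0]].
exists (a *: u + u'); first by apply hM.
exists (a *: v + v'); first by apply hN.
by rewrite scalerDr addrACA.
Qed.

Lemma sum_subl V (M N : set V) : submodule N -> M `<=` sum_sub M N.
Proof.
by move=> hN u Mu; exists u => //; exists 0; [exact: submod0|rewrite addr0].
Qed.

Lemma sum_subr V (M N : set V) : submodule M -> N `<=` sum_sub M N.
Proof.
by move=> hN u Mu; exists 0; [exact: submod0|exists u => //; rewrite add0r].
Qed.

Lemma sum_sub_min V (M N P : set V) : submodule P ->
  M `<=` P -> N `<=` P -> sum_sub M N `<=` P.
Proof.
by move=> hP MP NP _ [u Mu [v Nv <-]]; apply: submodD; [|apply: MP|apply: NP].
Qed.

Lemma submodule_modular V (W W' N : set V) : submodule W -> submodule W' ->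
  W `<=` W' -> W' `&` N `<=` W -> W' `<=` sum_sub W N -> W' `<=` W.
Proof.
move=> hW hW' le hI hS w' W'w'; have [u Wu [v Nv def]] := hS _ W'w'.
rewrite -def; apply: submodD => //; apply: hI; split=> //.
have -> : v = w' - u by rewrite -def addrAC subrr add0r.
by apply: submodB => //; apply: le.
Qed.

(** Chains of [N / M] and [P / N] concatenate. Conversely each strict step of a
    chain [W_i] of [P / M] is strict for [W_i \cap N] or for [W_i + N], by
    modularity, which bounds the number of steps. *)
Lemma has_lengthD V (M N P : set V) a b :
  submodule M -> submodule N -> submodule P -> M `<=` N -> N `<=` P ->
  has_length N M a -> has_length P N b -> has_length P M (a + b).
Proof.
move=> hM hN hP MN NP [[K [KC Ks]] amax] [[L [LC Ls]] bmax]; split.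
  exists (fun i => if (i <= a)%N then K i else L (i - a)%N); split=> i il.
    case: leqP => ia.
      by have [h1 h2 h3] := KC i ia; split=> //; apply: subset_trans NP.
    have [|h1 h2 h3] := LC (i - a)%N; first by rewrite leq_subLR.
    by split=> //; apply: subset_trans h2.
  have [ia|ai] := ltnP i a; first by rewrite (ltnW ia); apply: Ks.
  have lt : L (i - a)%N `<` L (i.+1 - a)%N.
    by rewrite subSn //; apply: Ls; rewrite ltn_subLR.
  case: leqP => // ia.
  have ei : i = a by apply/eqP; rewrite eqn_leq ia.
  have KL : K i `<=` L (i - a)%N.
    have [_ _ h] := KC i ia.
    have [|_ h' _] := LC (i - a)%N; first by rewrite ei subnn.
    exact: subset_trans h h'.
  case: lt => h1 h2; split=> [|h]; first exact: subset_trans h1.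
  by apply: h2; apply: subset_trans KL.
move=> k [Q [QC Qs]].
have QI : (\sum_(i < k) `[< Q i `&` N `<` Q i.+1 `&` N >] <= a)%N.
  apply: amax; apply: (@has_chain_steps _ _ (fun i => Q i `&` N)) => i ik.
    have [h1 h2 h3] := QC i ik; split; [exact: submoduleI| |by move=> ? []].
    by move=> u Mu; split; [apply: h2|apply: MN].
  by apply: setSI; case: (Qs i ik).
have QD : (\sum_(i < k) `[< sum_sub (Q i) N `<` sum_sub (Q i.+1) N >] <= b)%N.
  apply: bmax; apply: (@has_chain_steps _ _ (fun i => sum_sub (Q i) N)) => i ik.
    have [h1 h2 h3] := QC i ik; split.
    - exact: submodule_sum.
    - exact: sum_subr.
    - exact: sum_sub_min.
  have [h _] := Qs i ik; have [? _ _] := QC _ ik.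
  apply: sum_sub_min; first exact: submodule_sum.
    by move=> u /h; apply: sum_subl.
  exact: sum_subr.
apply: leq_trans (leq_add QI QD); rewrite -big_split /=.
rewrite -[leqLHS]card_ord -sum1_card; apply: leq_sum => i _.
have [le nle] := Qs i (ltn_ord i).
have [hQ _ _] := QC i (ltnW (ltn_ord i)); have [hQ' _ _] := QC i.+1 (ltn_ord i).
case: asboolP => // nI; case: asboolP => // nS; exfalso; apply: nle.
apply: (@submodule_modular _ _ _ N) => //.
  apply: contrapT => h; apply: nI; split; first exact: setSI.
  by move=> h'; apply: h => u /h' [].
apply: contrapT => h; apply: nS; split.
  apply: sum_sub_min; first exact: submodule_sum.
    by move=> u /le; apply: sum_subl.
  exact: sum_subr.
by move=> h'; apply: h => u /(sum_subl hN)/h'.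
Qed.

Lemma finite_length_sub V (M N P Q : set V) : submodule N ->
  M `<=` N -> N `<=` P -> P `<=` Q -> finite_length Q M -> finite_length P N.
Proof.
move=> hN MN NP PQ [l [_ lmax]].
apply: (@chain_height_bounded _ _ l); first by exists N; split.
move=> k hk; apply: lmax; apply: (has_chain_homo (g := id)) hk => // W [? h1 h2].
by split=> //; [apply: subset_trans h1|apply: subset_trans PQ].
Qed.

Lemma lengthD V (M N P : set V) :
  submodule M -> submodule N -> submodule P -> M `<=` N -> N `<=` P ->
  finite_length P M -> length P M = (length N M + length P N)%N.
Proof.
move=> hM hN hP MN NP fl.
have f1 : finite_length N M by apply: finite_length_sub fl.
have f2 : finite_length P N by apply: finite_length_sub fl.
apply: lengthE; apply: (@has_lengthD _ M N P) => //; exact: finite_lengthP.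
Qed.

Lemma has_length_refl V (M : set V) : submodule M -> has_length M M 0.
Proof.
move=> hM; split; first by exists (fun=> M); split=> // i _; split.
case=> // k [L [LC Ls]]; have [_ h0 _] := LC 0%N isT.
by have [_ _ h1] := LC 1%N isT; have [_ []] := Ls 0%N isT; apply: subset_trans h0.
Qed.

(** In this section [phi] induces an isomorphism from [N / M] onto [N' / M'];
    it is stated through elements, so that quotient modules never have to be
    formed. *)
Section Isomorphism.
Variables (V U : lmodType R) (phi : V -> U).
Variables (N M : set V) (N' M' : set U).
Hypothesis phiP : linear phi.
Hypotheses (hN : submodule N) (hN' : submodule N') (hM' : submodule M').
Hypothesis phiN : forall v, N v -> N' (phi v).
Hypothesis phiM : forall v, N v -> M' (phi v) <-> M v.
Hypothesis phi_surj : forall u, N' u -> exists2 v, N v & M' (u - phi v).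
Hypotheses (MN : M `<=` N) (MN' : M' `<=` N').

Let phi0 : phi 0 = 0.
Proof. by have := phiP (-1) 0 0; rewrite scaleN1r oppr0 addr0 scaleN1r addNr. Qed.

Let phiB u v : phi (u - v) = phi u - phi v.
Proof. by have := phiP (-1) v u; rewrite !scaleN1r ![- _ + _]addrC. Qed.

Lemma interval_image W : interval N M W -> interval N' M' (sum_sub (phi @` W) M').
Proof.
move=> [hW MW WN].
have h : submodule (phi @` W).
  split=> [|a _ _ [u Wu <-] [v Wv <-]].
    by exists 0; rewrite ?phi0 //; exact: submod0.
  by exists (a *: u + v); [apply hW|rewrite phiP].
split; [exact: submodule_sum|exact: sum_subr|apply: sum_sub_min => //].
by move=> _ [u /WN Nu <-]; apply: phiN.
Qed.

Lemma interval_preimage W : interval N' M' W -> interval N M (N `&` phi @^-1` W).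
Proof.
move=> [hW MW WN]; split; last by move=> ? [].
  apply: submoduleI => //; split=> [|a u v Wu Wv] /=.
    by rewrite phi0; exact: submod0.
  by rewrite phiP; apply hW.
by move=> v Mv; split; [apply: MN|apply/MW/phiM => //; apply: MN].
Qed.

Lemma has_chain_iso l : has_chain (interval N M) l <-> has_chain (interval N' M') l.
Proof.
split.
  apply: has_chain_homo; first exact: interval_image.
  move=> W W' [hW MW WN] [hW' MW' WN'] [le nle]; split.
    by move=> _ [_ [u /le W'u <-] [v M'v <-]]; exists (phi u); [exists u|exists v].
  move=> h; apply: nle => w W'w.
  have : sum_sub (phi @` W') M' (phi w) by apply: sum_subl => //; exists w.
  move=> /h [_ [v Wv <-] [u M'u def]].
  rewrite -[w](subrK v); apply: submodD => //; apply: MW; apply/phiM.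
    by apply: submodB => //; [apply: WN'|apply: WN].
  by rewrite phiB -def addrAC subrr add0r.
apply: has_chain_homo; first exact: interval_preimage.
move=> W W' [hW MW WN] [hW' MW' WN'] [le nle]; split.
  by move=> v [Nv /le]; split.
move=> h; apply: nle => w W'w; have [v Nv M'v] := phi_surj (WN' _ W'w).
have [_ Wv] : (N `&` phi @^-1` W) v.
  apply: h; split=> //=; rewrite -[phi v](subKr w); apply: submodB => //.
  exact: MW'.
by rewrite -[w](subrK (phi v)); apply: submodD => //; apply: MW.
Qed.

Lemma has_length_iso l : has_length N M l <-> has_length N' M' l.
Proof.
by split=> -[h hm]; split; try exact/has_chain_iso;
  move=> k /has_chain_iso; exact: hm.
Qed.

Lemma length_iso : length N M = length N' M'.
Proof.
rewrite /length; congr xget; apply/funext => l; apply/propext; exact: has_length_iso.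
Qed.

End Isomorphism.

Section DirectSum.
Variables (T : finType) (B A : T -> set R^o).
Hypotheses (hB : forall t, submodule (B t)) (hA : forall t, submodule (A t)).
Hypothesis AB : forall t, A t `<=` B t.
Hypothesis fAB : forall t, finite_length (B t) (A t).

Definition ffun_sub (C : T -> set R^o) : set {ffun T -> R^o} :=
  [set f | forall t, C t (f t)].

Lemma submodule_ffun_sub C : (forall t, submodule (C t)) -> submodule (ffun_sub C).
Proof.
move=> hC; split=> [t|a u v hu hv t]; first by rewrite ffunE; exact: submod0.
by rewrite !ffunE; apply hC.
Qed.

Lemma has_length_ffun_sub :
  has_length (ffun_sub B) (ffun_sub A) (\sum_t length (B t) (A t)).
Proof.
(* Enlarge the coordinates from [A t] to [B t] one at a time. *)
pose C (s : seq T) t := if t \in s then B t else A t.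
have hC s t : submodule (C s t) by rewrite /C; case: ifP.
suff main s : uniq s ->
    has_length (ffun_sub (C s)) (ffun_sub A) (\sum_(t <- s) length (B t) (A t)).
  have := main _ (enum_uniq T); rewrite big_enum /=.
  congr (has_length (ffun_sub _) _ _).
  by apply/funext => t; rewrite /C mem_enum.
elim: s => [|t s IH] /=.
  rewrite big_nil => _; apply: has_length_refl; exact: submodule_ffun_sub.
move=> /andP[ts us]; rewrite big_cons addnC.
have CS t' : C s t' `<=` C (t :: s) t'.
  rewrite /C inE; case: eqP => [->|_] /=; last exact: subset_refl.
  by rewrite (negPf ts); exact: AB.
have Cn t' : A t' `<=` C s t' by rewrite /C; case: ifP => _; [exact: AB|].
apply: (@has_lengthD _ _ (ffun_sub (C s))) => //; try exact: submodule_ffun_sub.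
- by move=> f hf t'; apply/Cn/hf.
- by move=> f hf t'; apply/CS/hf.
- exact: IH.
pose ev (f : {ffun T -> R^o}) : R^o := f t.
have lev : linear ev by move=> a u v; rewrite /ev !ffunE.
apply/(has_length_iso (phi := ev) (N' := B t) (M' := A t)) => //.
- exact: submodule_ffun_sub.
- by move=> v /(_ t); rewrite /C inE eqxx.
- move=> v hv; split=> [Av t'|/(_ t)]; last by rewrite /C (negPf ts).
  by have := hv t'; rewrite /C inE; case: eqP => [->|//]; rewrite (negPf ts).
- move=> u Bu; exists [ffun t' => if t' == t then u else 0].
    move=> t'; rewrite ffunE; case: eqP => [->|_]; last exact: submod0.
    by rewrite /C inE eqxx.
  by rewrite /= /ev ffunE eqxx subrr; exact: submod0.
- by move=> f hf t'; apply/CS/hf.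
- exact: finite_lengthP.
Qed.

End DirectSum.
End Length.

(** * Ideals and quotients of finite length *)

Section IdealTheory.
Variable R : comNzRingType.
Implicit Types (A B C : set R) (a b u v : R).

Section Closure.
Variable A : set R.
Hypothesis hA : ideal A.

Lemma ideal0 : A 0. Proof. exact: (submod0 hA). Qed.
Lemma idealD u v : A u -> A v -> A (u + v). Proof. exact: (submodD hA). Qed.
Lemma idealB u v : A u -> A v -> A (u - v). Proof. exact: (submodB hA). Qed.
Lemma idealMl a u : A u -> A (a * u). Proof. exact: (submodZ hA). Qed.
Lemma idealMr a u : A u -> A (u * a). Proof. by rewrite mulrC; exact: idealMl. Qed.
Lemma ideal_sum (I : Type) (r : seq I) (P : pred I) (f : I -> R) :
  (forall i, P i -> A (f i)) -> A (\sum_(i <- r | P i) f i).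
Proof. exact: (submod_sum hA). Qed.

End Closure.

Lemma idealP A : A 0 -> (forall a u v, A u -> A v -> A (a * u + v)) -> ideal A.
Proof. by []. Qed.

Lemma ideal_setT : ideal [set: R].
Proof. by []. Qed.

Lemma ideal_gen_ideal (X : set R) : ideal (ideal_gen X).
Proof.
apply: idealP => [A [hA _]|a u v hu hv A hAX]; first exact: ideal0.
case: (hAX) => hA _; apply: idealD => //; last exact: hv.
by apply: idealMl => //; apply: hu.
Qed.

Lemma ideal_gen0 (X : set R) : ideal_gen X 0.
Proof. exact: (ideal0 (ideal_gen_ideal X)). Qed.

Lemma sub_ideal_gen (X : set R) : X `<=` ideal_gen X.
Proof. by move=> u Xu A [_]; apply. Qed.

Lemma ideal_gen_min (X A : set R) : ideal A -> X `<=` A -> ideal_gen X `<=` A.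
Proof. by move=> hA XA u; apply. Qed.

Lemma ideal_mulP A B a b : A a -> B b -> ideal_mul A B (a * b).
Proof. by move=> Aa Bb; apply: sub_ideal_gen; exists a => //; exists b. Qed.

Lemma ideal_mul_ideal A B : ideal (ideal_mul A B).
Proof. exact: ideal_gen_ideal. Qed.

Lemma ideal_mul_min A B C : ideal C ->
  (forall a b, A a -> B b -> C (a * b)) -> ideal_mul A B `<=` C.
Proof. by move=> hC h; apply: ideal_gen_min => // _ [a Aa [b Bb <-]]; exact: h. Qed.

Lemma ideal_mulS A B C : B `<=` C -> ideal_mul A B `<=` ideal_mul A C.
Proof.
move=> BC; apply: ideal_mul_min; first exact: ideal_mul_ideal.
by move=> a b Aa /BC; exact: ideal_mulP.
Qed.

Lemma ideal_mul_sub A B : ideal B -> ideal_mul A B `<=` B.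
Proof. by move=> hB; apply: ideal_mul_min => // a b _; exact: idealMl. Qed.

(** For [B = R] this is the ideal generated by [y], and for an ideal [B] it is
    the product of [(y)] and [B]; relations between the [y j] are easier to
    manipulate with explicit coefficients. *)
Definition comb d (y : 'I_d -> R) B : set R :=
  [set \sum_j y j * b j | b in [set b : 'I_d -> R | forall j, B (b j)]].

Lemma comb_ideal d (y : 'I_d -> R) B : ideal B -> ideal (comb y B).
Proof.
move=> hB; apply: idealP.
  exists (fun=> 0) => [j|]; first exact: ideal0.
  by rewrite big1 // => j _; rewrite mulr0.
move=> a _ _ [b Bb <-] [c Bc <-]; exists (fun j => a * b j + c j) => [j|].
  by apply: idealD => //; apply: idealMl.
by rewrite mulr_sumr -big_split /=; apply: eq_bigr => j _; rewrite mulrDr mulrCA.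
Qed.

Lemma comb1 d (y : 'I_d -> R) B j b : ideal B -> B b -> comb y B (y j * b).
Proof.
move=> hB Bb; exists (fun k => if k == j then b else 0) => [k|].
  by case: ifP => // _; exact: ideal0.
rewrite (bigD1 j) //= eqxx big1 ?addr0 // => k /negPf->; exact: mulr0.
Qed.

Lemma ideal_gen_comb d (y : 'I_d -> R) : ideal_gen (range y) = comb y setT.
Proof.
apply/seteqP; split.
  apply: ideal_gen_min; first exact: comb_ideal.
  by move=> _ [j _ <-]; rewrite -[y j]mulr1; exact: comb1.
move=> _ [b _ <-]; apply: ideal_sum => [|j _]; first exact: ideal_gen_ideal.
by apply: (idealMr (@ideal_gen_ideal _)); apply: sub_ideal_gen; exists j.
Qed.

Lemma ideal_mul_comb d (y : 'I_d -> R) B : ideal B ->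
  ideal_mul (ideal_gen (range y)) B = comb y B.
Proof.
move=> hB; apply/seteqP; split.
  apply: ideal_mul_min; first exact: comb_ideal.
  move=> a b; rewrite ideal_gen_comb => -[c _ <-] Bb.
  rewrite mulr_suml; apply: ideal_sum => [|j _]; first exact: comb_ideal.
  by rewrite -mulrA; apply: comb1 => //; apply: idealMl.
move=> _ [b Bb <-]; apply: ideal_sum => [|j _]; first exact: ideal_mul_ideal.
by apply: ideal_mulP => //; apply: sub_ideal_gen; exists j.
Qed.

Lemma radicalS A B : A `<=` B -> radical A `<=` radical B.
Proof. by move=> AB u [k Ak]; exists k; apply: AB. Qed.

(** Without a maximal element, choice produces a strictly increasing sequence,
    whose union is an ideal with finitely many generators, all of which lie in
    one term. *)
Lemma noetherian_maximal (S : set (set R)) :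
  noetherian R -> (forall A, S A -> ideal A) -> S !=set0 ->
  exists2 A, S A & forall B, S B -> A `<=` B -> B `<=` A.
Proof.
move=> noeth SI [A0 SA0]; apply: contrapT => nmax.
have /choice[f fP] : forall A, exists B, S A -> [/\ S B, A `<=` B & ~ B `<=` A].
  move=> A; apply: contrapT => /forallNP h; apply: nmax; exists A.
    by apply: contrapT => nSA; apply: (h A).
  move=> B SB AB; apply: contrapT => nBA.
  by apply: (h B) => _; split.
pose L k := iter k f A0.
have SL k : S (L k) by elim: k => //= k /fP[].
have Lle k l : (k <= l)%N -> L k `<=` L l.
  elim: l => [|l IH]; first by rewrite leqn0 => /eqP->.
  rewrite leq_eqVlt => /orP[/eqP->//|/IH h].
  by apply: subset_trans h _; case: (fP _ (SL l)).
pose U := \bigcup_k L k.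
have [|n [g defU]] := noeth U.
  apply: idealP; first by exists 0%N => //; exact: (ideal0 (SI _ (SL 0%N))).
  move=> a u v [k _ Lu] [l _ Lv]; exists (maxn k l) => //.
  have hI := SI _ (SL (maxn k l)).
  apply: idealD => //; first apply: idealMl => //.
    by apply: Lle Lu; exact: leq_maxl.
  by apply: Lle Lv; exact: leq_maxr.
have /choice[N NP] : forall j, exists N, L N (g j).
  move=> j; have : U (g j) by rewrite defU; apply: sub_ideal_gen; exists j.
  by case=> N _; exists N.
have UL : U `<=` L (\max_j N j).
  rewrite defU; apply: ideal_gen_min; first exact: SI.
  by move=> _ [j _ <-]; apply: Lle (NP j); exact: leq_bigmax.
have [_ _] := fP _ (SL (\max_j N j)); apply; apply: subset_trans UL.
by move=> u Lu; exists (\max_j N j).+1.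
Qed.

Variable m : set R.
Hypotheses (noeth : noetherian R) (loc : local_ring m).

(** A maximal element among the proper ideals containing [a] is a maximal
    ideal, so it would be [m]. *)
Lemma local_unit a : ~ m a -> exists b, b * a = 1.
Proof.
move=> nma; apply: contrapT => nu.
pose P := [set A | [/\ ideal A, A a & ~ A 1]].
have hP : P [set b * a | b in setT].
  split; last by move=> [b _ e]; apply: nu; exists b.
    apply: idealP; first by exists 0 => //; rewrite mul0r.
    move=> c _ _ [u _ <-] [v _ <-]; exists (c * u + v) => //.
    by rewrite mulrDl mulrA.
  by exists 1 => //; rewrite mul1r.
have [||M [hM Ma nM1] Mmax] := @noetherian_maximal P noeth.
- by move=> A [].
- by eexists; exact: hP.
apply: nma; rewrite -(loc.2 M) //; split=> // B hB MB nB1.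
by apply/seteqP; split=> //; apply: Mmax => //; split=> //; apply: MB.
Qed.

(** Noetherian induction: if [R / A] is not zero, some [a] outside [A] is killed
    by [m] modulo [A], namely one whose annihilator modulo [A] is as large as
    possible; it contributes one simple factor. *)
Lemma finite_length_quotient A : ideal A -> m `<=` radical A ->
  finite_length (V := R^o) setT A.
Proof.
move=> hA mA; apply: contrapT => infA.
pose S := [set B |
  [/\ ideal B, m `<=` radical B & ~ finite_length (V := R^o) setT B]].
have [||{hA mA infA}B [hB mB infB] Bmax] := @noetherian_maximal S noeth.
- by move=> ? [].
- by exists A.
have nB1 : ~ B 1.
  move=> B1; apply: infB; exists 0%N.
  have -> : B = [set: R].
    by apply/seteqP; split=> // u _; rewrite -[u]mulr1; apply: idealMl.
  exact: has_length_refl.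
pose colon a := [set u | B (u * a)].
pose Q := [set C | exists2 a, ~ B a & C = colon a].
have [||_ [a nBa ->] amax] := @noetherian_maximal Q noeth.
- move=> _ [a nBa ->]; apply: idealP; rewrite /colon /=.
    by rewrite mul0r; exact: ideal0.
  by move=> c u v Bu Bv; rewrite mulrDl -mulrA; apply: idealD => //; apply: idealMl.
- by exists (colon 1); exists 1.
have ma u : m u -> B (u * a).
  move=> mu; have [k Buk] := mB _ mu.
  have {Buk} : B (u ^+ k * a) by apply: idealMr.
  elim: k => [|k IH]; first by rewrite mul1r.
  have [//|nB] := pselect (B (u ^+ k * a)); first by move=> ? _; apply: IH.
  rewrite exprS -mulrA => Bu; apply: (amax (colon (u ^+ k * a))) => //.
    by exists (u ^+ k * a).
  by move=> v Bv; rewrite /colon /= mulrCA; apply: idealMl.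
pose D := [set u | exists r, B (u - r * a)].
have BD : B `<=` D by move=> u Bu; exists 0; rewrite mul0r subr0.
have hD : ideal D.
  apply: idealP; first by apply: BD; exact: ideal0.
  move=> c u v [r Bu] [r' Bv]; exists (c * r + r').
  rewrite mulrDl opprD addrACA -mulrA -mulrBr.
  by apply: idealD => //; apply: idealMl.
have Da : D a by exists 1; rewrite mul1r subrr; exact: ideal0.
have fD : finite_length (V := R^o) setT D.
  apply: contrapT => nfD; apply: nBa; apply: (Bmax D) => //; split=> //.
  exact: subset_trans (radicalS BD).
have fDB : finite_length (V := R^o) D B.
  apply: (@chain_height_bounded _ _ 1%N); first by exists B; split.
  move=> [|[|k]] // [L [LC Ls]]; exfalso.
  have [_ BL0 _] := LC 0%N isT; have [hL1 _ L1D] := LC 1%N isT.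
  have [_ _ L2D] := LC 2%N isT.
  have [_ nL10] := Ls 0%N isT; have [_ nL21] := Ls 1%N isT.
  apply: nL21; apply: subset_trans L2D _ => u [r Bu].
  have [w L1w nBw] : exists2 w, L 1%N w & ~ B w.
    apply: contrapT => h; apply: nL10 => w L1w; apply: BL0; apply: contrapT => nB.
    by apply: h; exists w.
  have BL1 : B `<=` L 1%N by apply: subset_trans BL0 _; case: (Ls 0%N isT).
  have [t Bt] := L1D _ L1w.
  have [|c ct] := @local_unit t.
    by move=> /ma Bta; apply: nBw; rewrite -[w](subrK (t * a)); apply: idealD.
  have L1a : L 1%N a.
    rewrite -[a]mul1r -ct -mulrA -[t * a](subKr w).
    by apply: (idealMl hL1); apply: (idealB hL1) => //; apply: BL1.
  rewrite -[u](subrK (r * a)); apply: (idealD hL1); first exact: BL1.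
  exact: (idealMl hL1).
case: fD => k hk; case: fDB => l hl; apply: infB; exists (l + k)%N.
exact: (@has_lengthD _ R^o B D setT).
Qed.

End IdealTheory.

(** * The Koszul complex and its acyclicity *)

Section KoszulDifferential.
Variables (R : comNzRingType) (d : nat) (y : 'I_d -> R).
Implicit Types (j k : 'I_d) (T S : {set 'I_d}) (z w : exterior R d).

Local Notation kd := (koszul_diff y).

Definition ksign j T : R := (-1) ^+ #|[pred k in T | (k < j)%N]|.

Lemma ksignU1 j k T : k \notin T ->
  ksign j (k |: T)%SET = (-1) ^+ (k < j)%N * ksign j T.
Proof.
have cntE (U : {set 'I_d}) :
    #|[pred k in U | (k < j)%N]| = (\sum_(l in U) (l < j)%N)%N.
  by rewrite -sum1_card -big_mkcondr.
by move=> kT; rewrite /ksign !cntE big_setU1 //= exprD.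
Qed.

Lemma ksign_sqr j T : ksign j T * ksign j T = 1.
Proof. by rewrite -expr2 sqrr_sign. Qed.

Lemma ksign_swap j k T : j != k -> j \notin T -> k \notin T ->
  ksign j T * ksign k (j |: T)%SET = - (ksign k T * ksign j (k |: T)%SET).
Proof.
move=> jk jT kT; rewrite !ksignU1 //.
have : (j < k)%N || (k < j)%N by rewrite -neq_ltn.
by case: ltngtP => // _ _; rewrite expr0 expr1; ring.
Qed.

Lemma koszul_diffE z T :
  kd z T = \sum_(j < d | j \notin T) ksign j T * y j * z (j |: T)%SET.
Proof. by rewrite ffunE. Qed.

Lemma koszul_diff_linear : linear kd.
Proof.
move=> a u v; apply/ffunP => T.
rewrite !ffunE /= scaler_sumr -big_split /=.
by apply: eq_bigr => j _; rewrite !ffunE mulrDr; congr (_ + _); exact: mulrCA.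
Qed.

Lemma koszul_diffD u v : kd (u + v) = kd u + kd v.
Proof. by have := koszul_diff_linear 1 u v; rewrite !scale1r. Qed.

Lemma koszul_diffZ a u : kd (a *: u) = a *: kd u.
Proof.
apply/ffunP => T; rewrite !ffunE scaler_sumr.
by apply: eq_bigr => j _; rewrite ffunE; exact: mulrCA.
Qed.

Lemma koszul_diff0 : kd 0 = 0.
Proof. by rewrite -[0](scale0r 0) koszul_diffZ !scale0r. Qed.

Lemma koszul_diffB u v : kd (u - v) = kd u - kd v.
Proof. by rewrite koszul_diffD -scaleN1r koszul_diffZ scaleN1r. Qed.

Lemma koszul_diff_sum (I : Type) (r : seq I) (f : I -> exterior R d) :
  kd (\sum_(i <- r) f i) = \sum_(i <- r) kd (f i).
Proof. exact: (big_morph kd koszul_diffD koszul_diff0). Qed.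

Lemma koszul_diff_mem (A : set R) z : ideal A ->
  (forall T, A (z T)) -> forall T, A (kd z T).
Proof.
move=> hA hz T; rewrite koszul_diffE; apply: ideal_sum => // j _; exact: idealMl.
Qed.

Lemma sum_antisym (G : 'I_d -> 'I_d -> R) :
  (forall j, G j j = 0) -> (forall j k, j != k -> G j k = - G k j) ->
  \sum_j \sum_k G j k = 0.
Proof.
move=> G0 GN.
have -> : \sum_j \sum_k G j k =
    \sum_(j < d) \sum_(k < d | (k < j)%N) G j k +
    \sum_(j < d) \sum_(k < d | (j < k)%N) G j k.
  rewrite -big_split /=; apply: eq_bigr => j _.
  rewrite (bigID (fun k : 'I_d => (k < j)%N)) /=; congr (_ + _).
  rewrite (bigD1 j) ?ltnn //= G0 add0r; apply: eq_bigl => k.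
  by rewrite -leqNgt [RHS]ltn_neqAle andbC eq_sym.
rewrite [X in _ + X](exchange_big_dep predT) //= -big_split /= big1 // => j _.
rewrite -big_split /= big1 // => k kj; rewrite [G k j]GN ?subrr //.
by apply: contraTneq kj => ->; rewrite ltnn.
Qed.

Lemma koszul_diff_diff z : kd (kd z) = 0.
Proof.
apply/ffunP => T; rewrite koszul_diffE [RHS]ffunE.
pose G j k : R := if [&& j \notin T, k \notin T & j != k] then
  ksign j T * ksign k (j |: T)%SET * (y j * y k * z (k |: (j |: T))%SET) else 0.
rewrite -[RHS](@sum_antisym G).
- rewrite big_mkcond; apply: eq_bigr => j _; rewrite /G.
  case: ifP => jT; last by rewrite big1.
  rewrite koszul_diffE mulr_sumr big_mkcond; apply: eq_bigr => k _ /=.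
  rewrite !inE negb_or eq_sym andbC; case: ifP => // _.
  by ring.
- by move=> j; rewrite /G eqxx !andbF.
- move=> j k jk; rewrite /G jk eq_sym jk !andbT andbC.
  case: ifP => [/andP[kT jT]|_]; last by rewrite oppr0.
  by rewrite ksign_swap // mulNr [y j * _]mulrC finset.setUCA.
Qed.

(** Left multiplication by [e_j] in the exterior algebra. *)
Definition wedge j z : exterior R d :=
  [ffun T : {set 'I_d} => if j \in T then ksign j T * z (T :\ j)%SET else 0].

(** The reason why elements of the ideal [(y)] annihilate Koszul homology, with
    coefficients in any quotient of [R]. *)
Lemma wedge_homotopy j z : kd (wedge j z) + wedge j (kd z) = y j *: z.
Proof.
apply/ffunP => T; rewrite [LHS]ffunE [RHS]ffunE koszul_diffE [wedge j (kd z) T]ffunE.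
case: ifPn => jT; last first.
  rewrite addr0 (bigD1 j) //= ffunE finset.setU11 finset.setU1K //.
  rewrite ksignU1 // ltnn mul1r.
  rewrite big1 ?addr0 => [|k /andP[kT kj]]; last first.
    by rewrite ffunE !inE eq_sym (negPf kj) (negPf jT) mulr0.
  by rewrite mulrA -[_ * y j * _]mulrAC ksign_sqr mul1r.
rewrite -(finset.setD1K jT); set U := (T :\ j)%SET.
have jU : j \notin U by rewrite !inE eqxx.
rewrite finset.setU1K // ksignU1 // ltnn mul1r koszul_diffE.
rewrite [X in _ + _ * X](bigD1 j) //=.
rewrite mulrDr addrCA !mulrA ksign_sqr mul1r mulr_sumr.
rewrite -[RHS]addr0; congr (_ + _).
rewrite (eq_bigl (fun k => (k \notin U) && (k != j))); last first.
  by move=> k; rewrite !inE negb_or andbC; case: eqP.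
rewrite -big_split /= big1 // => k /andP[kU kj].
have jk : j != k by rewrite eq_sym.
have jkU : j \notin (k |: U)%SET by rewrite finset.in_setU1 negb_or jk.
rewrite ffunE finset.setUCA finset.setU11 finset.setU1K // !ksignU1 // ltnn.
have : (j < k)%N || (k < j)%N by rewrite -neq_ltn.
case: ltngtP => // _ _; ring.
Qed.

Lemma submodule_koszul_deg i : submodule (koszul_deg (R := R) (d := d) i).
Proof.
split=> [S _|a u v hu hv S Si]; first by rewrite ffunE.
by rewrite !ffunE hu // hv // addr0; exact: scaler0.
Qed.

Lemma koszul_diff_deg i z : koszul_deg i.+1 z -> koszul_deg i (kd z).
Proof.
move=> hz T Ti; rewrite koszul_diffE big1 // => j jT.
by rewrite hz ?mulr0 // cardsU1 jT add1n => -[].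
Qed.

Lemma koszul_diff_deg0 z : koszul_deg 0 z -> kd z = 0.
Proof.
move=> hz; apply/ffunP => T; rewrite koszul_diffE [RHS]ffunE big1 // => j jT.
by rewrite hz ?mulr0 // cardsU1 jT.
Qed.

Lemma wedge_deg i j z : koszul_deg i z -> koszul_deg i.+1 (wedge j z).
Proof.
move=> hz T Ti; rewrite ffunE; case: ifP => // jT; rewrite hz ?mulr0 // => e.
by apply: Ti; rewrite (cardsD1 j) jT add1n e.
Qed.

Lemma koszul_deg_gt i z : (d < i)%N -> koszul_deg i z -> z = 0.
Proof.
move=> di hz; apply/ffunP => S; rewrite [RHS]ffunE hz // => e.
by have := max_card (mem S); rewrite card_ord e leqNgt di.
Qed.

(** Lifts chosen coordinate by coordinate need not be homogeneous; this
    projection makes them so. *)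
Definition koszul_cut i z : exterior R d :=
  [ffun S : {set 'I_d} => if #|S| == i then z S else 0].

Lemma koszul_cutE i z S : koszul_cut i z S = if #|S| == i then z S else 0.
Proof. by rewrite ffunE. Qed.

Lemma koszul_cut_deg i z : koszul_deg i (koszul_cut i z).
Proof. by move=> S Si; rewrite ffunE; case: eqP. Qed.

(** The element [\sum_j b_j e_j] of degree one. *)
Definition koszul_vec (b : 'I_d -> R) : exterior R d :=
  [ffun T : {set 'I_d} => \sum_(j < d | T == [set j]%SET) b j].

Lemma koszul_vecE b j : koszul_vec b [set j]%SET = b j.
Proof.
rewrite ffunE (big_pred1 j) // => k; rewrite /= eq_sym.
by apply/eqP/eqP => [/finset.set1_inj|->].
Qed.

Lemma koszul_vec_deg b : koszul_deg 1 (koszul_vec b).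
Proof.
move=> T T1; rewrite ffunE big_pred0 // => j.
by apply/eqP => eT; apply: T1; rewrite eT cards1.
Qed.

Lemma koszul_diff_set0 z : kd z finset.set0 = \sum_j y j * z [set j]%SET.
Proof.
rewrite koszul_diffE; apply: eq_big => [j|j _]; first by rewrite finset.in_set0.
have -> : ksign j finset.set0 = 1.
  by rewrite /ksign (_ : #|_| = 0%N) // eq_card0 // => l; rewrite !inE.
by rewrite mul1r finset.setU0.
Qed.

Lemma koszul_diff_vec b : kd (koszul_vec b) finset.set0 = \sum_j y j * b j.
Proof. by rewrite koszul_diff_set0; apply: eq_bigr => j _; rewrite koszul_vecE. Qed.

Lemma exteriorB z w T : (z - w) T = z T - w T.
Proof. by rewrite [LHS]ffunE; congr (_ + _); rewrite ffunE. Qed.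

Lemma koszul_deg0_eq0 z : koszul_deg 0 z -> z finset.set0 = 0 -> z = 0.
Proof.
move=> hz z0; apply/ffunP => T; rewrite [RHS]ffunE.
have [->//|T0] := eqVneq T finset.set0; apply: hz => /eqP.
by rewrite cards_eq0 (negPf T0).
Qed.

End KoszulDifferential.

Section Acyclicity.
Variables (R : comNzRingType) (d : nat) (y : 'I_d -> R) (xs : seq R).
Hypotheses (xreg : regular_seq xs) (xsize : size xs = d).
Hypothesis xrad : forall t, (t < d)%N -> radical (comb y setT) xs`_t.

Local Notation kd := (koszul_diff y).
Local Notation Xi t := (ideal_gen [set` take t xs]).
Implicit Types z w : exterior R d.

Lemma ideal_gen_takeS t u : (t < d)%N ->
  Xi t.+1 u -> exists r, Xi t (u - xs`_t * r).
Proof.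
move=> td; pose A := [set u | exists r, Xi t (u - xs`_t * r)].
apply: (@ideal_gen_min _ _ A).
  apply: idealP; first by exists 0; rewrite mulr0 subr0; exact: ideal_gen0.
  move=> a {}u v [r Xu] [r' Xv]; exists (a * r + r').
  have -> : a * u + v - xs`_t * (a * r + r') =
      a * (u - xs`_t * r) + (v - xs`_t * r') by ring.
  apply: (idealD (@ideal_gen_ideal _ _)) => //.
  by apply: (idealMl (@ideal_gen_ideal _ _)).
move=> v /=; rewrite (take_nth 0) ?xsize // mem_rcons inE => /orP[/eqP->|vt].
  by exists 1; rewrite mulr1 subrr; exact: ideal_gen0.
by exists 0; rewrite mulr0 subr0; exact: sub_ideal_gen.
Qed.

Definition boundary_mod (A : set R) i z :=
  exists2 w, koszul_deg i.+1 w & forall T, A (z T - kd w T).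

(** A power of [x_(t+1)] lies in [(y)], hence kills the homology of [y] over
    [R / (x_1, ..., x_t)]. In degrees above [t], however, [x_(t+1)] acts
    injectively on it, by the long exact sequence and the vanishing over
    [R / (x_1, ..., x_(t+1))]. The descent starts at [t = d], where the complex
    itself is zero. *)
Lemma koszul_acyclic_mod t i z : (t <= d)%N -> (t < i)%N -> koszul_deg i z ->
  (forall T, Xi t (kd z T)) -> boundary_mod (Xi t) i z.
Proof.
move=> td; move: (subnKC td); move: (d - t)%N => c.
elim: c t td i z => [|c IH] t td i z.
  rewrite addn0 => -> di hz _; exists 0 => [T _|T]; first by rewrite ffunE.
  rewrite (koszul_deg_gt di hz) koszul_diff0 subrr.
  exact: ideal_gen0.
rewrite addnS => tcd ti hz dz.
have {}td : (t < d)%N by rewrite -tcd ltnS leq_addr.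
have hX : ideal (Xi t) by exact: ideal_gen_ideal.
set x := xs`_t.
(* Injectivity of [x] on homology: if [x u = kd w] modulo [(x_1, ..., x_t)], then
   [w] is a cycle modulo [(x_1, ..., x_(t+1))] of degree [i + 1 > t + 1], so
   [w = kd v + x w'] up to [(x_1, ..., x_t)], and [u = kd w'] after division by
   [x]. *)
have cancel u : boundary_mod (Xi t) i (x *: u) -> boundary_mod (Xi t) i u.
  move=> [w wi hw].
  have hX1 : Xi t.+1 x.
    by apply: sub_ideal_gen; rewrite /= (take_nth 0) ?xsize // mem_rcons inE eqxx.
  have XS v : Xi t v -> Xi t.+1 v.
    apply: ideal_gen_min; first exact: ideal_gen_ideal.
    move=> v' /= h; apply: sub_ideal_gen.
    by rewrite /= (take_nth 0) ?xsize // mem_rcons inE h orbT.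
  have [||||v vi hv] := IH t.+1 td i.+1 w => //.
    move=> T; rewrite -[kd w T](subKr (x * u T)).
    apply: (idealB (@ideal_gen_ideal _ _)).
      by apply: (idealMr (@ideal_gen_ideal _ _)).
    by apply: XS; have := hw T; rewrite ffunE.
  have /choice[r hr] : forall T, exists r, Xi t (w T - kd v T - x * r).
    by move=> T; apply: ideal_gen_takeS.
  pose w' := koszul_cut i.+1 [ffun T => r T].
  have hw' T : Xi t (w T - kd v T - x * w' T).
    rewrite /w' koszul_cutE; case: eqP => [_|Ti].
      by rewrite [X in _ * X]ffunE; exact: hr.
    by rewrite wi // (koszul_diff_deg y vi) // mulr0 !subr0; exact: (ideal0 hX).
  exists w'; first exact: koszul_cut_deg.
  move=> T; have [_ /(_ t (u T - kd w' T))] := xreg; apply; first by rewrite xsize.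
  have -> : x * (u T - kd w' T) =
      ((x *: u) T - kd w T) + kd (w - kd v - x *: w') T.
    rewrite !koszul_diffB koszul_diff_diff koszul_diffZ !ffunE.
    rewrite subr0 /GRing.scale /=; ring.
  apply: (idealD hX) => //; apply: koszul_diff_mem => // S.
  by have := hw' S; rewrite !ffunE.
have [k [a _ xk]] := xrad td.
suff : boundary_mod (Xi t) i (x ^+ k *: z).
  elim: k {xk} => [|k IHk]; first by rewrite scale1r.
  by rewrite exprS -scalerA => /cancel.
exists (\sum_j a j *: wedge j z).
  apply: (submod_sum (@submodule_koszul_deg _ _ _)) => j _.
  by apply: (submodZ (@submodule_koszul_deg _ _ _)); exact: wedge_deg.
move=> T; have -> : (x ^+ k *: z) T - kd (\sum_j a j *: wedge j z) T =
    \sum_j a j * wedge j (kd z) T.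
  rewrite koszul_diff_sum sum_ffunE [X in X - _]ffunE -/x -xk /GRing.scale /=.
  rewrite mulr_suml -sumrB; apply: eq_bigr => j _.
  rewrite koszul_diffZ [X in _ - X]ffunE /GRing.scale /=.
  have /(congr1 (fun f : exterior R d => f T)) := wedge_homotopy y j z.
  rewrite [LHS]ffunE [RHS]ffunE /GRing.scale /= => e.
  by rewrite mulrAC -e; ring.
apply: (ideal_sum hX) => // j _; apply: (idealMl hX) => //; rewrite ffunE.
by case: ifP => _; [apply: (idealMl hX)|exact: (ideal0 hX)].
Qed.

Lemma koszul_acyclic i z : koszul_deg i.+1 z -> kd z = 0 ->
  exists2 w, koszul_deg i.+2 w & kd w = z.
Proof.
move=> hz dz; have X0 : Xi 0 = [set 0 : R].
  rewrite take0; apply/seteqP; split=> [u|_ ->]; last exact: ideal_gen0.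
  by apply=> //; split=> //; apply: idealP => // a v w -> ->; rewrite mulr0 addr0.
have [||||w wi hw] := @koszul_acyclic_mod 0 i.+1 z => // [T|].
  by rewrite dz ffunE; exact: ideal_gen0.
exists w => //; apply/ffunP => T; apply/esym/eqP; rewrite -subr_eq0; apply/eqP.
by have := hw T; rewrite X0.
Qed.

(** The relation is a cycle of degree one; it bounds because [H_1] vanishes, and
    the coordinate of index [j] of a boundary is a combination of the other
    [y k]. So each [y j] is a nonzerodivisor modulo the others. *)
Lemma comb_others_cancel j a (b : 'I_d -> R) :
  y j * a = \sum_(k < d | k != j) y k * b k ->
  exists c : 'I_d -> R, a = \sum_(k < d | k != j) y k * c k.
Proof.
move=> e; pose z := koszul_vec (fun k => if k == j then a else - b k).
have [||w hw wz] := @koszul_acyclic 0 z; first exact: koszul_vec_deg.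
  apply: koszul_deg0_eq0; first exact/koszul_diff_deg/koszul_vec_deg.
  rewrite koszul_diff_vec (bigD1 j) //= eqxx e -big_split /= big1 // => k /negPf->.
  by rewrite mulrN subrr.
exists (fun k => ksign R k [set j]%SET * w (k |: [set j])%SET).
have := koszul_vecE (fun k => if k == j then a else - b k) j.
rewrite eqxx -/z -wz => <-; rewrite koszul_diffE.
by apply: eq_big => [k|k _]; [rewrite inE|ring].
Qed.

End Acyclicity.

(** * Powers of an ideal generated by a system of parameters *)

Section Radical.
Variable R : comNzRingType.
Implicit Types A : set R.

Lemma ideal_expr_le A u k l : ideal A -> (k <= l)%N -> A (u ^+ k) -> A (u ^+ l).
Proof. by move=> hA kl; rewrite -(subnK kl) exprD; apply: (idealMl hA). Qed.

Lemma radical_ideal A : ideal A -> ideal (radical A).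
Proof.
move=> hA; apply: idealP; first by exists 1%N; rewrite expr1; exact: ideal0.
move=> a u v [k Au] [l Av]; exists (k + l)%N; rewrite exprDn.
apply: (ideal_sum hA) => i _; rewrite -mulr_natr; apply: (idealMr hA).
have [li|il] := leqP l i.
  by apply: (idealMl hA); exact: ideal_expr_le Av.
apply: (idealMr hA); rewrite exprMn; apply: (idealMl hA).
by apply: ideal_expr_le Au => //; rewrite -addnBA ?leq_addr // ltnW.
Qed.

Lemma radical_idem A u k : radical A (u ^+ k) -> radical A u.
Proof. by move=> [l h]; exists (k * l)%N; rewrite exprM. Qed.

Lemma comb_sub_radical A d (y : 'I_d -> R) : ideal A ->
  (forall j, radical A (y j)) -> comb y setT `<=` radical A.
Proof.
move=> hA hy _ [b _ <-]; apply: (ideal_sum (radical_ideal hA)) => j _.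
exact: (idealMr (radical_ideal hA)).
Qed.

Lemma ideal_pow_ideal A k : ideal (ideal_pow A k).
Proof. by case: k => [|k]; [exact: ideal_setT|exact: ideal_mul_ideal]. Qed.

Lemma ideal_powM A k l u v :
  ideal_pow A k u -> ideal_pow A l v -> ideal_pow A (k + l) (u * v).
Proof.
elim: k u => [|k IH] u; first by move=> _; exact: (idealMl (ideal_pow_ideal _ _)).
rewrite addSn => Au Av; move: u Au.
apply: (@ideal_mul_min _ _ _ [set u | ideal_pow A (k + l).+1 (u * v)]).
  apply: idealP.
    by rewrite /mkset mul0r; exact: (ideal0 (ideal_pow_ideal _ (k + l).+1)).
  move=> a u w hu hw; rewrite /mkset mulrDl -mulrA.
  apply: (idealD (ideal_pow_ideal _ (k + l).+1)) => //.
  exact: (idealMl (ideal_pow_ideal _ (k + l).+1)).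
by move=> a b Aa Ab; rewrite /mkset -mulrA; apply: ideal_mulP => //; exact: IH.
Qed.

Lemma ideal_powX A n u : A u -> ideal_pow A n (u ^+ n).
Proof. by move=> Au; elim: n => // n IH; rewrite exprS; exact: ideal_mulP. Qed.

Lemma ideal_powS A k : ideal_pow A k.+1 `<=` ideal_pow A k.
Proof. by apply: ideal_mul_sub; exact: ideal_pow_ideal. Qed.

End Radical.

Section Monomials.
Variables (R : comNzRingType) (d : nat) (y : 'I_d -> R).
Implicit Types (c e : 'I_d -> nat).

Definition monomial c : R := \prod_j y j ^+ c j.

Definition power_ideal e : set R := comb (fun j => y j ^+ e j) setT.

Lemma power_ideal_ideal e : ideal (power_ideal e).
Proof. exact: comb_ideal. Qed.

Lemma monomial_power_ideal c e j a :
  (e j <= c j)%N -> power_ideal e (a * monomial c).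
Proof.
move=> ec; rewrite /monomial (bigD1 j) //= -(subnKC ec) exprD mulrCA -mulrA.
exact: (@comb1 _ _ (fun j => y j ^+ e j)).
Qed.

Lemma monomial_ideal_pow c :
  ideal_pow (comb y setT) (\sum_j c j) (monomial c).
Proof.
rewrite /monomial.
apply: (big_rec2 (fun n u => ideal_pow (comb y setT) n u)) => // j n u _ hu.
apply: ideal_powM => //; apply: ideal_powX.
by rewrite -[y j]mulr1; exact: comb1.
Qed.

Section Degree.
Variable k : nat.

(** The exponent vectors of the monomials of degree [k], as a finite type; tuples
    with entries at most [k] are the form in which they are counted by a binomial
    coefficient. *)
Definition exponents := {t : d.-tuple 'I_k.+1 | (\sum_(i <- t) i == k)%N}.

Definition exponent (t : exponents) (j : 'I_d) : nat := tnth (val t) j.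

Lemma sum_exponent (t : exponents) : (\sum_j exponent t j = k)%N.
Proof. by have /eqP := valP t; rewrite big_tuple. Qed.

Lemma exponents_surj c : (\sum_j c j = k)%N -> exists t, exponent t =1 c.
Proof.
move=> ck; have ub j : (c j < k.+1)%N by rewrite -ck ltnS (bigD1 j) //= leq_addr.
pose t := [tuple inord (c j) : 'I_k.+1 | j < d].
have tE j : tnth t j = c j :> nat by rewrite tnth_mktuple inordK.
have tk : (\sum_(i <- t) i == k)%N.
  rewrite big_tuple; apply/eqP; rewrite -[RHS]ck.
  by apply: eq_bigr => j _; exact: tE.
by exists (exist _ t tk).
Qed.

Lemma exponent_inj (t t' : exponents) :
  (forall j, (exponent t j <= exponent t' j)%N) -> t = t'.
Proof.
move=> le; apply/val_inj/eq_from_tnth => j; apply/val_inj/eqP => /=.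
rewrite eqn_leq le /=.
have : (\sum_i exponent t i = \sum_i exponent t' i)%N by rewrite !sum_exponent.
rewrite (bigD1 j) //= [RHS](bigD1 j) //= => e.
rewrite leqNgt; apply/negP => lt; move/eqP: e; apply/negP; rewrite ltn_eqF //.
by rewrite -addSn leq_add // leq_sum.
Qed.

Lemma card_exponents : (0 < d)%N -> #|{: exponents}| = 'C(d.-1 + k, d.-1).
Proof.
rewrite card_sig; case: (d) => // d' _; rewrite -card_ord_partitions cardsE.
by apply: eq_card => t; rewrite !inE.
Qed.

Definition eval_form (f : {ffun exponents -> R^o}) : R^o :=
  \sum_t f t * monomial (exponent t).

Lemma eval_form_linear : linear eval_form.
Proof.
move=> a u v; rewrite /eval_form scaler_sumr -big_split /=.
by apply: eq_bigr => t _; rewrite !ffunE mulrDl /GRing.scale /= mulrA.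
Qed.

Lemma range_eval_form_ideal : ideal (range eval_form).
Proof.
apply: idealP.
  by exists 0 => //; rewrite /eval_form big1 // => t _; rewrite ffunE mul0r.
move=> a _ _ [u _ <-] [v _ <-]; exists (a *: u + v) => //.
by rewrite eval_form_linear.
Qed.

Lemma range_eval_form1 c a : (\sum_j c j = k)%N -> range eval_form (a * monomial c).
Proof.
move=> /exponents_surj[t tE]; exists [ffun t' => if t' == t then a else 0] => //.
rewrite /eval_form (bigD1 t) //= ffunE eqxx big1 ?addr0 => [|t' /negPf tt].
  by rewrite /monomial; congr (_ * _); apply: eq_bigr => j _; rewrite tE.
by rewrite ffunE tt mul0r.
Qed.

End Degree.

Lemma ideal_pow_range k : ideal_pow (comb y setT) k = range (eval_form (k := k)).
Proof.
apply/seteqP; split; last first.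
  move=> _ [f _ <-]; apply: (ideal_sum (ideal_pow_ideal _ _)) => t _.
  apply: (idealMl (ideal_pow_ideal _ _)); rewrite -[X in ideal_pow _ X](sum_exponent t).
  exact: monomial_ideal_pow.
elim: k => [|k IH].
  move=> a _; rewrite -[a]mulr1.
  have -> : 1 = monomial (fun=> 0%N) by rewrite /monomial big1.
  by apply: range_eval_form1; rewrite big1.
rewrite /ideal_pow iterS -/(ideal_pow _ k) -ideal_gen_comb.
rewrite ideal_mul_comb; last by exact: ideal_pow_ideal.
move=> _ [b hb <-]; apply: (ideal_sum (@range_eval_form_ideal _)) => j _.
have : range (eval_form (k := k)) (b j) by apply: IH; rewrite -ideal_gen_comb.
move=> [f _ <-]; rewrite /eval_form mulr_sumr.
apply: (ideal_sum (@range_eval_form_ideal _)) => t _; rewrite mulrCA.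
have -> : y j * monomial (exponent t) = monomial (fun l => (l == j) + exponent t l)%N.
  rewrite /monomial (bigD1 j) //= [RHS](bigD1 j) //= eqxx exprS mulrA; congr (_ * _).
  by apply: eq_bigr => l /negPf->.
apply: range_eval_form1; rewrite big_split /= sum_exponent (bigD1 j) //= eqxx.
by rewrite big1 // => l /negPf->.
Qed.

(** A monomial of larger degree has an exponent exceeding that of [c]. *)
Lemma ideal_pow_power_ideal c n : (\sum_j c j < n)%N ->
  ideal_pow (comb y setT) n `<=` power_ideal (fun j => (c j).+1).
Proof.
move=> cn u; rewrite ideal_pow_range => -[f _ <-].
apply: (ideal_sum (@power_ideal_ideal _)) => t _.
have /existsP[j cj] : [exists j, c j < exponent t j]%N.
  apply: contraTT cn => /existsPn h; rewrite -leqNgt -(sum_exponent t).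
  by apply: leq_sum => j _; rewrite leqNgt h.
exact: (@monomial_power_ideal _ _ j).
Qed.

(** [A] contains a power of each [y j], and a monomial of large degree is
    divisible by one of these powers. *)
Lemma ideal_pow_sub (A : set R) : ideal A -> (0 < d)%N ->
  (forall j, radical A (y j)) -> exists n, ideal_pow (comb y setT) n `<=` A.
Proof.
move=> hA d0 /choice[e he]; exists (\sum_j e j).+1.
apply: subset_trans (@ideal_pow_power_ideal e _ (ltnSn _)) _ => _ [b _ <-].
apply: (ideal_sum hA) => j _; apply: (idealMr hA).
by apply: ideal_expr_le (he j) => //; exact: leqnSn.
Qed.

End Monomials.

Section QuasiRegular.
Variables (R : comNzRingType) (d : nat) (y : 'I_d -> R) (xs : seq R).
Hypotheses (xreg : regular_seq xs) (xsize : size xs = d).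
Hypothesis xrad : forall t, (t < d)%N -> radical (comb y setT) xs`_t.
Local Notation J := (comb y setT).

(** One index [j] at a time: since [y_j ^ c_j] is a nonzerodivisor modulo
    powers of the other [y_k], a relation modulo [y_j ^ (c_j + 1)] can be divided
    by [y_j ^ c_j]. *)
Lemma monomial_colon (c : 'I_d -> nat) a :
  power_ideal y (fun j => (c j).+1) (a * monomial y c) -> J a.
Proof.
move=> ha; pose E (s : seq 'I_d) k := if k \in s then 1%N else (c k).+1.
suff main s : uniq s ->
    power_ideal y (E s) (a * \prod_(j < d | j \notin s) y j ^+ c j).
  have := main _ (enum_uniq 'I_d).
  rewrite big_pred0 => [|j]; last by rewrite mem_enum.
  rewrite mulr1 /power_ideal; congr (comb _ _ _); apply/funext => j.
  by rewrite /E mem_enum.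
elim: s => [_|j s IH /= /andP[js /IH{IH} [b _ hb]]].
  by rewrite /E /=; move: ha; rewrite /monomial.
(* The sequence in which [y_j ^ c_j] is a nonzerodivisor modulo the others; for
   [c_j = 0] it contains 1, and its homology still vanishes. *)
pose y' k := if k == j then y j ^+ c j else y k ^+ E s k.
set r := a * \prod_(k < d | k \notin j :: s) y k ^+ c k.
have prodE : \prod_(k < d | k \notin s) y k ^+ c k =
    y j ^+ c j * \prod_(k < d | k \notin j :: s) y k ^+ c k.
  rewrite (bigD1 j) //=; congr (_ * _); apply: eq_bigl => k.
  by rewrite inE negb_or andbC.
have rE : y' j * (r - y j * b j) = \sum_(k < d | k != j) y' k * b k.
  rewrite /y' eqxx mulrBr /r mulrCA -prodE -hb (bigD1 j) //= /E (negPf js) exprSr.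
  by rewrite mulrA addrAC subrr add0r; apply: eq_bigr => k /negPf->.
have y'rad t : (t < d)%N -> radical (comb y' setT) xs`_t.
  move=> td; have [k hk] := xrad td; apply: (@radical_idem _ _ _ k).
  apply: comb_sub_radical hk; first exact: comb_ideal.
  move=> l; exists (if l == j then c j else E s l).
  have -> : y l ^+ (if l == j then c j else E s l) = y' l * 1.
    by rewrite mulr1 /y'; case: eqP => // ->.
  exact: comb1.
have [b' rE'] := comb_others_cancel xreg xsize y'rad rE.
have -> : r = y j ^+ E (j :: s) j * b j +
    \sum_(k < d | k != j) y k ^+ E (j :: s) k * b' k.
  rewrite {1}/E mem_head expr1 -[LHS](subrK (y j * b j)) addrC rE'; congr (_ + _).
  apply: eq_bigr => k kj; rewrite /y' (negPf kj); congr (_ ^+ _ * _).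
  by rewrite /E inE (negPf kj).
apply: (idealD (@power_ideal_ideal _ _ _ _)).
  exact: (@comb1 _ _ (fun k => y k ^+ E (j :: s) k)).
apply: (ideal_sum (@power_ideal_ideal _ _ _ _)) => k _.
exact: (@comb1 _ _ (fun k => y k ^+ E (j :: s) k)).
Qed.

(** Fix a monomial [y^c] of degree [k]. All other monomials of degree [k], and
    [J^(k+1)], lie in the ideal of the powers [y_j ^ (c_j + 1)], so that
    [monomial_colon] isolates the coefficient of [y^c]. Hence [J^k / J^(k+1)] is
    free over [R / J] on the monomials of degree [k]. *)
Lemma eval_form_ideal_pow k (f : {ffun exponents d k -> R^o}) :
  ideal_pow J k.+1 (eval_form y f) <-> forall t, J (f t).
Proof.
split=> [Jf t|Jf]; last first.
  apply: (ideal_sum (ideal_pow_ideal _ _)) => t _.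
  apply: (@ideal_mulP _ J (ideal_pow J k)) => //.
  by rewrite -[X in ideal_pow _ X](sum_exponent t); exact: monomial_ideal_pow.
apply: (@monomial_colon (exponent t)).
have -> : f t * monomial y (exponent t) =
    eval_form y f - \sum_(t' | t' != t) f t' * monomial y (exponent t').
  by rewrite /eval_form (bigD1 t) //= addrK.
apply: (idealB (@power_ideal_ideal _ _ _ _)).
  by apply: ideal_pow_power_ideal Jf; rewrite sum_exponent.
apply: (ideal_sum (@power_ideal_ideal _ _ _ _)) => t' tt'.
have /existsP[j lt] : [exists j, exponent t j < exponent t' j]%N.
  apply: contraNT tt' => /existsPn h; apply/eqP/exponent_inj => j.
  by rewrite leqNgt h.
exact: (@monomial_power_ideal _ _ _ _ _ j).
Qed.

Hypotheses (d0 : (0 < d)%N) (fJ : finite_length (V := R^o) setT J).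

(** Each factor of the filtration by powers of [J] is a direct sum of copies of
    [R / J], one for each monomial of its degree. *)
Lemma has_length_ideal_pow k :
  has_length (V := R^o) setT (ideal_pow J k)
    (\sum_(i < k) 'C(d.-1 + i, d.-1) * length (V := R^o) setT J).
Proof.
elim: k => [|k IH]; first by rewrite big_ord0; exact: has_length_refl.
set S := ideal_pow J k.+1; rewrite big_ord_recr /= addnC {}/S.
have hI n : @submodule R R^o (ideal_pow J n) by exact: ideal_pow_ideal.
have hJ : @submodule R R^o J by exact: comb_ideal.
have -> : ('C(d.-1 + k, d.-1) * length (V := R^o) setT J =
    \sum_(t : exponents d k) length (V := R^o) setT J)%N.
  by rewrite sum_nat_const card_exponents.
apply: (@has_lengthD R R^o _ (ideal_pow J k)) => //; first exact: ideal_powS.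
have hl := @has_length_ffun_sub R (exponents d k) (fun=> setT) (fun=> J).
apply/(has_length_iso (phi := eval_form y (k := k))); last first.
- exact: hl.
- exact: ideal_powS.
- by move=> f _ t.
- move=> u; rewrite ideal_pow_range => -[f _ <-]; exists f => //.
  by rewrite subrr; exact: (submod0 (hI _)).
- by move=> f _; exact: eval_form_ideal_pow.
- by move=> f _; rewrite ideal_pow_range; exists f.
- exact: hI.
- exact: hI.
- exact: submodule_ffun_sub.
- exact: eval_form_linear.
Qed.

End QuasiRegular.

(** * Finite differences *)

Section Differences.
Implicit Types (f g : nat -> rat) (D : nat).

Definition diff f : nat -> rat := fun k => f k.+1 - f k.

Lemma iter_diffD D f g :
  iter D diff (fun k => f k + g k) = fun k => iter D diff f k + iter D diff g k.
Proof.
elim: D => //= D ->; apply/funext => k; rewrite /diff; ring.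
Qed.

Lemma iter_diffB D f g :
  iter D diff (fun k => f k - g k) = fun k => iter D diff f k - iter D diff g k.
Proof.
elim: D => //= D ->; apply/funext => k; rewrite /diff; ring.
Qed.

Lemma iter_diffZ D a f :
  iter D diff (fun k => f k * a) = fun k => iter D diff f k * a.
Proof.
elim: D => //= D ->; apply/funext => k; rewrite /diff; ring.
Qed.

Lemma iter_diff_shift D l f :
  iter D diff (fun k => f (l + k)%N) = fun k => iter D diff f (l + k)%N.
Proof. by elim: D => //= D ->; apply/funext => k; rewrite /diff addnS. Qed.

Lemma iter_diff0 D : iter D diff (fun=> 0) = fun=> 0.
Proof. by elim: D => //= D ->; apply/funext => k; rewrite /diff subrr. Qed.

Lemma iter_diff_binomial r f k :
  iter r diff f k = \sum_(i < r.+1) (-1) ^+ i * 'C(r, i)%:R * f (k + (r - i))%N.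
Proof.
elim: r k => [|r IH] k.
  by rewrite big_ord_recl big_ord0 /= bin0 !mul1r addr0 addn0.
rewrite iterS /diff !IH big_ord_recl /= bin0 !mul1r subn0.
rewrite [in RHS]big_ord_recl /= bin0 !mul1r subn0 addSnnS -!addrA; congr (_ + _).
transitivity (\sum_(i < r.+1) ((-1) ^+ i.+1 * 'C(r, i.+1)%:R * f (k + (r - i))%N
    - (-1) ^+ i * 'C(r, i)%:R * f (k + (r - i))%N) : rat).
  rewrite big_split /= sumrN; congr (_ + _).
  rewrite [RHS]big_ord_recr /= bin_small // mulr0 mul0r addr0.
  apply: eq_bigr => i _; rewrite /bump /= add1n; congr (_ * f _).
  by rewrite addSnnS -subSn.
apply: eq_bigr => i _; rewrite /bump /= add1n binS natrD subSS exprS; ring.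
Qed.

(** Sequences which are polynomial functions, characterised by the vanishing of
    an iterated difference. *)
Definition polynomial_seq f := exists D, iter D diff f = fun=> 0.

Lemma iter_diff_leq D D' f : (D <= D')%N ->
  iter D diff f = (fun=> 0) -> iter D' diff f = fun=> 0.
Proof. by move=> h e; rewrite -(subnK h) iterD e iter_diff0. Qed.

Lemma polynomial_seq_const a : polynomial_seq (fun=> a).
Proof. by exists 1%N; apply/funext => k; rewrite /= /diff subrr. Qed.

Lemma polynomial_seqD f g :
  polynomial_seq f -> polynomial_seq g -> polynomial_seq (fun k => f k + g k).
Proof.
move=> [a ha] [b hb]; exists (maxn a b); rewrite iter_diffD.
rewrite (iter_diff_leq (leq_maxl a b) ha) (iter_diff_leq (leq_maxr a b) hb).
by apply/funext => k; exact: addr0.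
Qed.

(** By the Leibniz rule, the orders of vanishing of the iterated differences of
    [f] and [g] add up. *)
Lemma polynomial_seqM f g :
  polynomial_seq f -> polynomial_seq g -> polynomial_seq (fun k => f k * g k).
Proof.
move=> [a ha] [b hb]; exists (a + b)%N.
move: {2}(a + b)%N (leqnn (a + b)) => N; elim: N a b f g ha hb => [|N IH] a b f g.
  rewrite leqn0 addn_eq0 => ha _ /andP[/eqP a0 /eqP b0].
  rewrite a0 b0 /=; rewrite a0 /= in ha; rewrite ha.
  by apply/funext => k; rewrite mul0r.
case: a => [/= ->|a] hf.
  by move=> *; rewrite (_ : (fun k => 0 * g k) = fun=> 0) ?iter_diff0 //;
    apply/funext => k; rewrite mul0r.
case: b => [/= ->|b] hg.
  by move=> *; rewrite (_ : (fun k => f k * 0) = fun=> 0) ?iter_diff0 //;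
    apply/funext => k; rewrite mulr0.
move=> abN; rewrite addSn iterSr.
have -> : diff (fun k => f k * g k) =
    fun k => diff f k * g (1 + k)%N + f k * diff g k.
  by apply/funext => k; rewrite /diff add1n; ring.
have le : (a + b.+1 <= N)%N by rewrite -ltnS -addSn.
have hu : iter (a + b.+1) diff (fun k => diff f k * g (1 + k)%N) = fun=> 0.
  by apply: IH => //; rewrite -?iterSr // iter_diff_shift hg.
have hv : iter (a.+1 + b) diff (fun k => f k * diff g k) = fun=> 0.
  by apply: IH => //; rewrite -?iterSr // addSnnS.
by rewrite iter_diffD hu -addSnnS hv; apply/funext => k; exact: addr0.
Qed.

Lemma polynomial_seqX f n : polynomial_seq f -> polynomial_seq (fun k => f k ^+ n).
Proof.
move=> hf; elim: n => [|n IH]; first exact: polynomial_seq_const.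
rewrite (_ : (fun k => _) = fun k => f k * f k ^+ n); first exact: polynomial_seqM.
by apply/funext => k; rewrite exprS.
Qed.

Lemma polynomial_seq_big (op : rat -> rat -> rat) idx (I : Type) (r : seq I)
    (P : pred I) (F : I -> nat -> rat) :
  (forall f g, polynomial_seq f -> polynomial_seq g ->
     polynomial_seq (fun k => op (f k) (g k))) ->
  (forall i, polynomial_seq (F i)) ->
  polynomial_seq (fun k => \big[op/idx]_(i <- r | P i) F i k).
Proof.
move=> hop hF; elim: r => [|i r IH].
  rewrite (_ : (fun k => _) = fun=> idx); first exact: polynomial_seq_const.
  by apply/funext => k; rewrite big_nil.
rewrite (_ : (fun k => _) = fun k =>
    if P i then op (F i k) (\big[op/idx]_(i <- r | P i) F i k)
    else \big[op/idx]_(i <- r | P i) F i k); last first.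
  by apply/funext => k; rewrite big_cons.
by case: (P i); [apply: hop|].
Qed.

Lemma polynomial_seq_meval s (P : {mpoly rat[s]}) (v : nat -> 'I_s -> rat) :
  (forall i, polynomial_seq (fun k => v k i)) -> polynomial_seq (fun k => P.@[v k]).
Proof.
move=> hv; rewrite (_ : (fun k => _) =
  fun k => \sum_(m <- msupp P) P@_m * \prod_i v k i ^+ m i); last first.
  by apply/funext => k; rewrite mevalE.
apply: polynomial_seq_big => [|m]; first exact: polynomial_seqD.
apply: polynomial_seqM; first exact: polynomial_seq_const.
apply: polynomial_seq_big => [|i]; first exact: polynomial_seqM.
exact: polynomial_seqX.
Qed.

(** A sequence whose difference stays below [- eps] tends to minus infinity;
    iterating, the bound on the [D]-th difference descends to [f]. *)
Lemma eventually_negative D f eps l : 0 < eps ->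
  (forall k, (l <= k)%N -> iter D diff f k <= - eps) ->
  exists l', forall k, (l' <= k)%N -> f k <= - eps.
Proof.
move=> eps0; elim: D l => [|D IH] l hf; first by exists l.
pose b := Num.bound (`|iter D diff f l| / eps + 1).
apply: (IH (l + b)%N) => k /subnKC <-; move: (k - (l + b))%N => {}k.
have le j : iter D diff f (l + j)%N <= iter D diff f l - eps * j%:R.
  elim: j => [|j IHj]; first by rewrite addn0 mulr0 subr0.
  have := hf (l + j)%N (leq_addr _ _); rewrite iterS /diff addnS -natr1; lra.
rewrite -addnA; apply: le_trans (le _) _.
have hb : `|iter D diff f l| / eps + 1 < b%:R.
  by apply: archi_boundP; rewrite addr_ge0 // divr_ge0 // ltW.
have : `|iter D diff f l| + eps <= eps * b%:R.
  rewrite -[`|_|](divfK (lt0r_neq0 eps0)) [eps * _]mulrC -[X in _ + X]mul1r -mulrDl.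
  by rewrite ler_pM2r // ltW.
have : iter D diff f l <= `|iter D diff f l| by exact: ler_norm.
have : 0 <= eps * k%:R by rewrite mulr_ge0 // ltW.
by rewrite natrD mulrDr; lra.
Qed.

Lemma nonneg_leading_diff D f a :
  (forall k, 0 <= f k) -> (forall k, iter D diff f k = a) -> 0 <= a.
Proof.
move=> f0 fa; rewrite leNgt; apply/negP => a0.
have [||l hl] := @eventually_negative D f (- a) 0; rewrite ?oppr_gt0 //.
  by move=> k _; rewrite fa opprK.
by have := f0 l; have := hl l (leqnn _); rewrite opprK; lra.
Qed.

(** If the [d]-th differences were not equal, the distance of [f] to one of the
    two bounds would be a sequence of degree at least [d] with negative leading
    coefficient. *)
Lemma squeeze_diff d (f g : nat -> rat) a l c :
  polynomial_seq f -> (forall k, iter d diff g k = a) ->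
  (forall k, g k <= f (l + k)%N <= g (c + k)%N) ->
  forall k, iter d diff f k = a.
Proof.
move=> [D hD] ga fg; pose v k := iter d diff f k - a.
suff v0 : v = fun=> 0.
  by move=> k; apply/eqP; rewrite -subr_eq0; apply/eqP; rewrite -/(v k) v0.
have : iter D.+1 diff v = fun=> 0.
  rewrite /v iter_diffB -iterD addnC iterD (iter_diff_leq (leqnSn D) hD) iter_diff0.
  by rewrite iterSr (_ : diff (fun=> a) = fun=> 0) ?iter_diff0;
    apply/funext => k; rewrite /diff ?subrr // subr0.
elim: D.+1 => {D hD} [|j IH] // hj; apply: IH.
(* The [j]-th difference of [v] is a constant [b]; up to sign it is the
   [(j + d)]-th difference of the distance of [f] to each of its two bounds. *)
pose b := iter j diff v 0.
have vb k : iter j diff v k = b.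
  rewrite /b; elim: k => // k <-; apply/eqP; rewrite -subr_eq0; apply/eqP.
  by rewrite -[LHS]/(iter j.+1 diff v k) hj.
suff b0 : b = 0 by apply/funext => k; rewrite vb.
apply/eqP; rewrite eq_le; apply/andP; split.
  rewrite -oppr_ge0.
  apply: (@nonneg_leading_diff (j + d) (fun k => g (c + k)%N - f (l + k)%N)).
    by move=> k; rewrite subr_ge0; case/andP: (fg k).
  move=> k; rewrite iterD iter_diffB !iter_diff_shift -(vb (l + k)%N).
  rewrite -[RHS]sub0r (_ : (fun k => _) = fun k => 0 - v (l + k)%N); last first.
    by apply/funext => i; rewrite ga /v; ring.
  by rewrite iter_diffB iter_diff0 iter_diff_shift.
apply: (@nonneg_leading_diff (j + d) (fun k => f (l + k)%N - g k)).
  by move=> k; rewrite subr_ge0; case/andP: (fg k).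
move=> k; rewrite iterD iter_diffB iter_diff_shift -(vb (l + k)%N).
rewrite (_ : (fun k => _) = fun k => v (l + k)%N); last first.
  by apply/funext => i; rewrite ga.
by rewrite iter_diff_shift.
Qed.

Lemma iter_diff_bin r k : iter r diff (fun k => 'C(r + k, r)%:R) k = 1.
Proof.
elim: r k => [|r IH] k; first by rewrite /= bin0.
rewrite iterSr (_ : diff _ = fun k => 'C(r + (1 + k), r)%:R).
  by rewrite (iter_diff_shift r 1 (fun k => 'C(r + k, r)%:R)) IH.
apply/funext => i; rewrite /diff addnS binS natrD addrAC subrr add0r.
by rewrite add1n addSnnS.
Qed.

Lemma iter_diff_sum_bin d l k : (0 < d)%N ->
  iter d diff (fun k => (\sum_(i < k) 'C(d.-1 + i, d.-1) * l)%N%:R) k = l%:R.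
Proof.
case: d => // d _; rewrite iterSr (_ : diff _ = fun k => 'C(d + k, d)%:R * l%:R).
  by rewrite iter_diffZ iter_diff_bin mul1r.
by apply/funext => i; rewrite /diff big_ord_recr /= natrD addrAC subrr add0r natrM.
Qed.

End Differences.

Lemma delta_diff s d (f : 'rV[int]_s -> rat) n k :
  delta d f (n + evec s *+ k) = iter d diff (fun k => f (n + evec s *+ k)) k.
Proof.
rewrite /delta; elim: d k => // d IH k.
by rewrite !iterS /delta1 /diff -!IH mulrSr addrA.
Qed.

(** * Homology of the quotient complex *)

Section EulerCharacteristic.
Variables (R : comNzRingType) (s d : nat) (y : 'I_d -> R).
Variables (F : 'rV[int]_s -> set R).
Hypothesis hF : forall n, ideal (F n).
Hypothesis yF : forall n j u, F n u -> F (n + evec s) (y j * u).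
Hypothesis fF : forall n, finite_length (V := R^o) setT (F n).
Variable n : 'rV[int]_s.

Local Notation kd := (koszul_diff y).
Local Notation K i := (koszul_deg (R := R) (d := d) i).
Local Notation S i := (koszul_sub F n i : set (exterior R d)).
Local Notation Z i := (quot_cycles y F n i).
Local Notation B i := (quot_boundaries y F n i).
Local Notation e := (evec s).
Implicit Types z w u v : exterior R d.

Lemma submodule_koszul_sub i : submodule (S i).
Proof.
have hK := @submodule_koszul_deg R d i.
split=> [|a u v [hu Fu] [hv Fv]].
  split=> [|T]; first exact: (submod0 hK).
  by rewrite ffunE; exact: (ideal0 (hF _)).
split=> [|T]; first by apply hK.
by rewrite !ffunE; apply: (idealD (hF _)) => //; exact: (idealMl (hF _)).
Qed.

Lemma koszul_diff_sub i z : S i.+1 z -> S i (kd z).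
Proof.
move=> [zi Fz]; have [di|id] := leqP d i.
  rewrite (koszul_deg_gt _ zi) // koszul_diff0.
  exact: (submod0 (submodule_koszul_sub _)).
split=> [|T]; first exact: koszul_diff_deg.
rewrite koszul_diffE; apply: (ideal_sum (hF _)) => j _.
rewrite -mulrA; apply: (idealMl (hF _)); rewrite -subnSK // mulrSr addrA.
exact/yF/Fz.
Qed.

Lemma submodule_quot_cycles i : submodule (Z i).
Proof.
have hK := @submodule_koszul_deg R d i.
have hS := submodule_koszul_sub i.-1.
split=> [|a u v [hu Su] [hv Sv]].
  by split; [exact: (submod0 hK)|rewrite koszul_diff0; exact: (submod0 hS)].
by split; [apply hK|rewrite koszul_diff_linear; apply hS].
Qed.

Lemma submodule_quot_boundaries i : submodule (B i).
Proof.
have hK := @submodule_koszul_deg R d i.+1.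
have hS := submodule_koszul_sub i.
split=> [|a _ _ [u Ku [u' Su' <-]] [v Kv [v' Sv' <-]]].
  exists 0; first exact: (submod0 hK).
  by exists 0; [exact: (submod0 hS)|rewrite koszul_diff0 addr0].
exists (a *: u + v); first by apply hK.
exists (a *: u' + v'); first by apply hS.
by rewrite koszul_diff_linear scalerDr addrACA.
Qed.

Lemma koszul_sub_boundaries i : S i `<=` B i.
Proof.
move=> u Su; exists 0; first exact: (submod0 (@submodule_koszul_deg _ _ _)).
by exists u => //; rewrite koszul_diff0 add0r.
Qed.

Lemma boundaries_cycles i : B i `<=` Z i.
Proof.
move=> _ [w Kw [u Su <-]]; split.
  apply: (submodD (@submodule_koszul_deg _ _ _)); first exact: koszul_diff_deg.
  by case: Su.
rewrite koszul_diffD koszul_diff_diff add0r; case: i Kw Su => [|i] Kw Su.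
  rewrite koszul_diff_deg0; last by case: Su.
  exact: (submod0 (submodule_koszul_sub _)).
exact: koszul_diff_sub.
Qed.

Lemma has_length_koszul_term i : (i <= d)%N ->
  has_length (K i) (S i) ('C(d, i) * hilbert_fun F (n + e *+ (d - i))).
Proof.
move=> id.
pose A (T : {set 'I_d}) : set R^o :=
  if #|T| == i then F (n + e *+ (d - i)) else [set 0].
pose C (T : {set 'I_d}) : set R^o := if #|T| == i then setT else [set 0].
have h0 : submodule [set 0 : R^o].
  by split=> // a u v -> ->; rewrite scaler0 addr0.
have -> : K i = ffun_sub C.
  apply/seteqP; split=> z hz T.
    by rewrite /C; case: eqP => // Ti; exact: hz.
  by move=> Ti; have := hz T; rewrite /C; case: eqP.
have -> : S i = ffun_sub A.
  apply/seteqP; split=> z => [[zi Fz] T|hz].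
    by rewrite /A; case: eqP => // Ti; exact: zi.
  split=> T; first by move=> Ti; have := hz T; rewrite /A; case: eqP.
  by have := hz T; rewrite /A; case: eqP => // _ ->; exact: (ideal0 (hF _)).
have -> : ('C(d, i) * hilbert_fun F (n + e *+ (d - i)) = \sum_T length (C T) (A T))%N.
  rewrite (bigID (fun T : {set 'I_d} => #|T| == i)) /= [X in (_ + X)%N]big1 ?addn0.
    rewrite (eq_bigr (fun=> hilbert_fun F (n + e *+ (d - i)))).
      rewrite sum_nat_const; congr (_ * _)%N.
      by have := card_draws 'I_d i; rewrite card_ord cardsE.
    by move=> T Ti; rewrite /C /A Ti.
  move=> T /negPf Ti; rewrite /C /A Ti; exact/lengthE/has_length_refl.
apply: has_length_ffun_sub => T; rewrite /A /C; case: eqP => _.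
- exact: submodule_setT.
- exact: h0.
- exact: hF.
- exact: h0.
- by [].
- exact: subset_refl.
- exact: fF.
- by exists 0%N; exact: has_length_refl.
Qed.

Lemma finite_length_koszul_term i : (i <= d)%N -> finite_length (K i) (S i).
Proof. by move=> id; eexists; exact: has_length_koszul_term. Qed.

Lemma cycles_deg i : Z i `<=` K i.
Proof. by move=> z []. Qed.

Lemma finite_length_quot_homology i : (i <= d)%N -> finite_length (Z i) (B i).
Proof.
move=> id; apply: (finite_length_sub _ _ _ _ (finite_length_koszul_term id)).
- exact: submodule_quot_boundaries.
- exact: koszul_sub_boundaries.
- exact: boundaries_cycles.
- exact: cycles_deg.
Qed.

Lemma length_koszul_term i : (i <= d)%N ->
  ('C(d, i) * hilbert_fun F (n + e *+ (d - i)) =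
   length (B i) (S i) + length_quot_homology y F n i + length (K i) (Z i))%N.
Proof.
move=> id; rewrite -(lengthE (has_length_koszul_term id)) /length_quot_homology.
have hS := submodule_koszul_sub i; have hB := submodule_quot_boundaries i.
have hZ := submodule_quot_cycles i; have hK := @submodule_koszul_deg R d i.
have fK := finite_length_koszul_term id.
have SB := @koszul_sub_boundaries i; have BZ := @boundaries_cycles i.
have ZK := @cycles_deg i; have SZ := subset_trans SB BZ.
have fZ := finite_length_sub hS (@subset_refl _ _) SZ ZK fK.
by rewrite (lengthD hS hZ hK SZ ZK fK) (lengthD hS hB hZ SB BZ fZ).
Qed.

(** The differential induces an isomorphism from chains modulo cycles onto
    boundaries one degree below. *)
Lemma length_chains_boundaries i : length (K i.+1) (Z i.+1) = length (B i) (S i).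
Proof.
apply: (length_iso (phi := kd)).
- exact: koszul_diff_linear.
- exact: submodule_koszul_deg.
- exact: submodule_quot_boundaries.
- exact: submodule_koszul_sub.
- move=> v Kv; exists v => //; exists 0; last by rewrite addr0.
  exact: (submod0 (submodule_koszul_sub _)).
- by move=> v Kv; split=> [|[]].
- by move=> _ [w Kw [u Su <-]]; exists w => //; rewrite addrAC subrr add0r.
- exact: cycles_deg.
- exact: koszul_sub_boundaries.
Qed.

(** The length of each term splits into boundaries, homology and chains modulo
    cycles; the first and the last contribution cancel between consecutive
    degrees. *)
Lemma euler_characteristic :
  \sum_(i < d.+1) (-1) ^+ i * 'C(d, i)%:R * (hilbert_fun F (n + e *+ (d - i)))%:R
  = \sum_(i < d.+1) (-1) ^+ i * (length_quot_homology y F n i)%:R :> rat.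
Proof.
have h0 : length (K 0) (Z 0) = 0%N.
  have -> : Z 0%N = K 0%N.
    apply/seteqP; split=> z; first exact: cycles_deg.
    move=> Kz; split=> //; rewrite koszul_diff_deg0 //.
    exact: (submod0 (submodule_koszul_sub _)).
  exact/lengthE/has_length_refl/submodule_koszul_deg.
have hd : length (B d) (S d) = 0%N.
  have -> : B d = S d.
    apply/seteqP; split=> z; last exact: koszul_sub_boundaries.
    by move=> [w Kw [u Su <-]]; rewrite (koszul_deg_gt _ Kw) // koszul_diff0 add0r.
  exact/lengthE/has_length_refl/submodule_koszul_sub.
pose b i : rat := (length (B i) (S i))%:R; pose k i : rat := (length (K i) (Z i))%:R.
transitivity (\sum_(i < d.+1) ((-1) ^+ i * b i + (-1) ^+ i * k i
   + (-1) ^+ i * (length_quot_homology y F n i)%:R)).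
  apply: eq_bigr => -[i /= id] _; rewrite -mulrA -natrM length_koszul_term //.
  by rewrite !natrD /b /k; ring.
rewrite !big_split /=.
have -> : \sum_(i < d.+1) (-1) ^+ i * b i = \sum_(i < d) (-1) ^+ i * b i.
  by rewrite big_ord_recr /= /b hd mulr0 addr0.
have -> : \sum_(i < d.+1) (-1) ^+ i * k i = - \sum_(i < d) (-1) ^+ i * b i.
  rewrite big_ord_recl /= /k h0 mulr0 add0r -sumrN; apply: eq_bigr => i _.
  by rewrite /bump add1n length_chains_boundaries exprS /b; ring.
by rewrite subrr add0r.
Qed.

Section LowHomology.
Hypothesis acyclic1 : forall z, K 1 z -> kd z = 0 -> exists2 w, K 2 w & kd w = z.
Hypothesis d0 : (0 < d)%N.
Local Notation J := (comb y setT : set R^o).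
Local Notation A := (F (n + e *+ d) : set R^o).
Local Notation A' := (F (n + e *+ (d - 1))).
Hypothesis fJ : finite_length setT J.

Let hA : submodule A. Proof. exact: hF. Qed.
Let hJ : submodule J. Proof. exact: comb_ideal. Qed.
Let hJA' : @submodule R R^o (comb y A'). Proof. exact: comb_ideal. Qed.

Lemma comb_filtration_sub : comb y A' `<=` A `&` J.
Proof.
move=> _ [b Ab <-]; split; last by exists b.
have <- : n + e *+ (d - 1) + e = n + e *+ d.
  by rewrite -addrA -mulrSr subn1 prednK.
by apply: (ideal_sum (hF _)) => j _; exact: yF.
Qed.

Lemma ev0_linear : linear (fun z : exterior R d => z finset.set0 : R^o).
Proof. by move=> a u v; rewrite !ffunE. Qed.

Lemma koszul_sub0 z : K 0 z -> A (z finset.set0) -> S 0 z.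
Proof.
move=> Kz Az; split=> // T; rewrite subn0.
have [->//|T0] := eqVneq T finset.set0.
rewrite Kz; first exact: (ideal0 (hF _)).
by move=> /eqP; rewrite cards_eq0 (negPf T0).
Qed.

Lemma length_quot_homology0 :
  length_quot_homology y F n 0 = length (V := R^o) setT (sum_sub J A).
Proof.
apply: (length_iso (phi := fun z : exterior R d => z finset.set0 : R^o)).
- exact: ev0_linear.
- exact: submodule_quot_cycles.
- exact: submodule_setT.
- exact: submodule_sum.
- by [].
- move=> z [Kz _]; split=> [[_ [b _ <-] [a Aa e0]]|[w Kw [u [Ku Su] <-]]].
    exists (koszul_vec b); first exact: koszul_vec_deg.
    exists (z - kd (koszul_vec b)); last by rewrite addrC subrK.
    apply: koszul_sub0.
      apply: (submodB (@submodule_koszul_deg _ _ _)) => //.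
      exact/koszul_diff_deg/koszul_vec_deg.
    by rewrite exteriorB koszul_diff_vec -e0 addrAC subrr add0r.
  exists (kd w finset.set0); last exists (u finset.set0).
  + rewrite koszul_diff_set0; apply: (ideal_sum (comb_ideal _ _)) => // j _.
    exact: comb1.
  + by have := Su finset.set0; rewrite subn0.
  + by rewrite [RHS]ffunE.
- move=> u _; exists [ffun T : {set 'I_d} => if T == finset.set0 then u else 0].
    have K0 : K 0 [ffun T : {set 'I_d} => if T == finset.set0 then u else 0].
      by move=> T T0; rewrite ffunE; case: eqP => // e0; case: T0; rewrite e0 cards0.
    split=> //; rewrite koszul_diff_deg0 //.
    exact: (submod0 (submodule_koszul_sub _)).
  by rewrite ffunE eqxx subrr; exact: (submod0 (submodule_sum _ _)).
- exact: boundaries_cycles.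
- by [].
Qed.

(** A cycle of degree one modulo the filtration is determined, up to boundaries,
    by the value of its differential in [J], because [H_1] of the full Koszul
    complex vanishes. *)
Lemma has_length_quot_homology1 :
  has_length (A `&` J) (comb y A') (length_quot_homology y F n 1).
Proof.
pose phi z : R^o := kd z finset.set0.
have phi_vec b : phi (koszul_vec b) = \sum_j y j * b j by exact: koszul_diff_vec.
have phiJ z : J (phi z).
  rewrite /phi koszul_diff_set0; apply: (ideal_sum (comb_ideal _ _)) => // j _.
  exact: comb1.
apply/(has_length_iso (phi := phi)); last first.
- exact/finite_lengthP/finite_length_quot_homology.
- by move=> u hu; exact: comb_filtration_sub.
- exact: boundaries_cycles.
- move=> u [Au [b _ eb]]; exists (koszul_vec b); last first.
    by rewrite phi_vec eb subrr; exact: (submod0 hJA').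
  split; first exact: koszul_vec_deg.
  apply: koszul_sub0; first exact/koszul_diff_deg/koszul_vec_deg.
  by rewrite -/(phi _) phi_vec eb.
- move=> z [Kz _]; split=> [[b Ab eb]|[w Kw [u [Ku Su] <-]]].
    have [||w Kw ew] := acyclic1 (z := z - koszul_vec b).
    + by apply: (submodB (@submodule_koszul_deg _ _ _)) => //; exact: koszul_vec_deg.
    + apply: koszul_deg0_eq0.
        apply/koszul_diff_deg/(submodB (@submodule_koszul_deg _ _ _)) => //.
        exact: koszul_vec_deg.
      rewrite koszul_diffB exteriorB -/(phi z) -/(phi (koszul_vec b)).
      by rewrite phi_vec eb subrr.
    exists w => //; exists (koszul_vec b); last by rewrite ew subrK.
    split=> [|T]; first exact: koszul_vec_deg.
    by rewrite ffunE; apply: (ideal_sum (hF _)) => j _; exact: Ab.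
  rewrite /phi koszul_diffD koszul_diff_diff add0r koszul_diff_set0.
  by exists (fun j => u [set j]%SET).
- move=> z [_ [_ /(_ finset.set0)]]; rewrite subn0 => Az; split=> //.
- exact: hJA'.
- exact: submoduleI.
- exact: submodule_quot_cycles.
- by move=> a u v; rewrite /phi koszul_diff_linear; exact: ev0_linear.
Qed.

(** Both sides differ from [length(R / (J + A))] and
    [length((A \cap J) / J A')] by the length of [(J + A) / J], which is
    isomorphic to [A / (A \cap J)]. *)
Lemma length_low_homology :
  (length_quot_homology y F n 0)%:R - (length_quot_homology y F n 1)%:R
  = (length (V := R^o) setT J)%:R - (length A (comb y A'))%:R :> rat.
Proof.
have hJA : submodule (sum_sub J A) by exact: submodule_sum.
have hAJ : submodule (A `&` J) by exact: submoduleI.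
have sJ : J `<=` sum_sub J A by exact: sum_subl.
have sJA : finite_length (sum_sub J A) J.
  exact: (finite_length_sub hJ _ sJ _ fJ).
have lA : has_length A (A `&` J) (length (sum_sub J A) J).
  apply/(has_length_iso (phi := id) (N' := sum_sub J A) (M' := J)) => //;
    last exact: finite_lengthP.
  - exact: sum_subr.
  - by move=> v Av; split=> [|[]].
  - by move=> _ [u Ju [v Av <-]]; exists v => //; rewrite addrK.
have l1 := has_length_quot_homology1.
have combAJ := comb_filtration_sub.
have AJA : A `&` J `<=` A by move=> ? [].
rewrite length_quot_homology0 (lengthE (has_lengthD hJA' hAJ hA combAJ AJA l1 lA)).
by rewrite (lengthD hJ hJA (submodule_setT _) sJ _ fJ) // !natrD; ring.
Qed.

End LowHomology.
End EulerCharacteristic.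

(** * Hilbert polynomials along diagonals *)

Section PowersOfIdeals.
Variables (R : comNzRingType) (s : nat) (I : 'I_s -> set R).

Lemma radical_ideal_mul (A B : set R) u :
  radical A u -> radical B u -> radical (ideal_mul A B) u.
Proof.
by move=> [k Ak] [l Bl]; exists (k + l)%N; rewrite exprD; exact: ideal_mulP.
Qed.

Lemma radical_ideal_mpow u n :
  (forall i, radical (I i) u) -> radical (ideal_mpow I n) u.
Proof.
have hT : radical [set: R] u by exists 0%N.
move=> hI; apply: (big_rec (fun A => radical A u)) => // i A _.
by apply: radical_ideal_mul; elim: absz => //= k; exact: radical_ideal_mul.
Qed.

Lemma yprod_mpow d (x : 'I_s -> 'I_d -> R) j :
  (forall i j, I i (x i j)) -> ideal_mpow I (evec s) (yprod x j).
Proof.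
move=> hx; apply: (big_rec2 (fun (A : set R) u => A u)) => // i A u _ Au.
apply: ideal_mulP => //; rewrite !mxE.
by rewrite -[x i j]expr1; exact: ideal_powX.
Qed.

End PowersOfIdeals.

Section Asymptotics.
Variables (R : comNzRingType) (s d : nat) (y : 'I_d -> R) (xs : seq R).
Variables (F : 'rV[int]_s -> set R) (P : {mpoly rat[s]}).
Hypotheses (xreg : regular_seq xs) (xsize : size xs = d) (d0 : (0 < d)%N).
Local Notation J := (comb y setT).
Hypothesis xrad : forall t, (t < d)%N -> radical J xs`_t.
Hypothesis hF : forall n, ideal (F n).
Hypothesis fF : forall n, finite_length (V := R^o) setT (F n).
Hypothesis fJ : finite_length (V := R^o) setT J.
Hypothesis yrad : forall n j, radical (F n) (y j).
Hypothesis JF : for_large (fun n => ideal_mul J (F n) = F (n + evec s)).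
Hypothesis hP : hilbert_poly F P.

Lemma for_large_diag (Q : 'rV[int]_s -> Prop) n : for_large Q ->
  exists l, forall k, (l <= k)%N -> Q (n + evec s *+ k).
Proof.
move=> [N hN]; exists (N + \sum_i absz (n ord0 i))%N => k lk; apply: hN => i.
have ni : (absz (n ord0 i) <= \sum_i absz (n ord0 i))%N.
  by rewrite (bigD1 i) //= leq_addr.
have -> : (n + evec s *+ k) ord0 i = n ord0 i + k%:Z.
  by rewrite mxE -scaler_nat !mxE mulr1 natz.
move: ni lk; set S := (\sum_i _)%N; lia.
Qed.

Lemma length_le (M N : set R) : ideal M -> ideal N -> M `<=` N ->
  finite_length (V := R^o) setT M ->
  (length (V := R^o) setT N <= length (V := R^o) setT M)%N.
Proof.
move=> hM hN MN fM.
by rewrite (@lengthD R R^o _ N setT hM hN (submodule_setT _) MN _ fM) ?leq_addl.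
Qed.

(** Along a diagonal [F (n + k e)] is eventually [J^(k - l) G] for a fixed ideal
    [G] containing some [J^c]. *)
Lemma diagonal_squeeze n : exists l c, forall k,
  ideal_pow J (c + k) `<=` F (n + evec s *+ (l + k)) /\
  F (n + evec s *+ (l + k)) `<=` ideal_pow J k.
Proof.
have [l hl] := for_large_diag n JF.
have [c hc] := ideal_pow_sub (hF (n + evec s *+ l)) d0 (yrad _).
exists l, c; elim=> [|k [IH1 IH2]]; first by rewrite !addn0; split.
rewrite !addnS mulrSr addrA -hl ?leq_addr //.
by split; apply: ideal_mulS.
Qed.

(** The squeeze only concerns large arguments, where [P] is the Hilbert function;
    but it determines the [d]-th difference of the polynomial sequence
    [k |-> P (n + k e)] at every [k], in particular at 0. *)
Lemma delta_hilbert_poly n :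
  delta d (fun k : 'rV[int]_s => P.@[fun i => (k ord0 i)%:~R]) n
  = (length (V := R^o) setT J)%:R.
Proof.
have := delta_diff d (fun k : 'rV[int]_s => P.@[fun i => (k ord0 i)%:~R]) n 0.
rewrite addr0 => ->.
have [l [c hlc]] := diagonal_squeeze n.
have [l' hP'] := for_large_diag n hP.
pose g k : rat := (\sum_(i < k) 'C(d.-1 + i, d.-1) * length (V := R^o) setT J)%N%:R.
have gE k : g k = (length (V := R^o) setT (ideal_pow J k))%:R.
  by rewrite (lengthE (has_length_ideal_pow xreg xsize xrad d0 fJ k)).
have hI k : ideal (ideal_pow J k) by exact: ideal_pow_ideal.
have fI k : finite_length (V := R^o) setT (ideal_pow J k).
  by eexists; exact: (has_length_ideal_pow xreg xsize xrad d0 fJ k).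
apply: (@squeeze_diff d _ (fun k => g (l' + k)%N) _ (l + l') c).
- apply: polynomial_seq_meval => i; exists 2%N; apply/funext => k.
  rewrite /= /diff !mulrSr !mxE !intrD; ring.
- by move=> k; rewrite (iter_diff_shift d l' g) iter_diff_sum_bin.
- move=> k; rewrite hP' /=; last by rewrite addnAC leq_addl.
  rewrite !gE !ler_nat /hilbert_fun -addnA; have [h1 h2] := hlc (l' + k)%N.
  by rewrite !length_le // addnCA.
Qed.

End Asymptotics.

Theorem theorem1p9 (R : comNzRingType) (m : set R) (d s : nat)
  (I : 'I_s -> set R) (F : 'rV[int]_s -> set R)
  (x : 'I_s -> 'I_d -> R) (P : {mpoly rat[s]})
  (hCM : cohen_macaulay_local m) (hdim : krull_dim R d)
  (hd : (1 <= d)%N) (hs : (1 <= s)%N)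
  (hres : infinite_residue_field m)
  (hI : forall i, m_primary m (I i))
  (hF : admissible I F)
  (hx : complete_reduction I F x)
  (hP : hilbert_poly F P)
  (n : 'rV[int]_s) :
  let y := yprod x in
  let J := ideal_gen (range y) in
  let e := evec s in
  delta d (fun k : 'rV[int]_s =>
             P.@[fun i => (k 0 i)%:~R] - (hilbert_fun F k)%:R) n
  = (length (V := R^o) (F (n + e *+ d)) (ideal_mul J (F (n + e *+ (d - 1)))))%:R
    - \sum_(2 <= i < d.+1) (-1) ^+ i * (length_quot_homology y F n i)%:R.
Proof.
move=> y J e.
have [noeth loc [d' [hdim' [[xs [xm xreg xsize]] _]]]] := hCM.
have {d' hdim'} xsize : size xs = d.
  by rewrite xsize; exact: chain_height_uniq hdim' hdim.
have [[Fid IF FM FS] _ _] := hF.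
have [xI JF] := hx.
have mF k : m `<=` radical (F k).
  move=> u mu; apply: radicalS (IF k) _ _; apply: radical_ideal_mpow => i.
  by case: (hI i) => _ ->.
have fF k : finite_length (V := R^o) setT (F k).
  by apply: (finite_length_quotient noeth loc) (mF k); exact: Fid.
have JE : J = comb y setT by exact: ideal_gen_comb.
have mJ : m `<=` radical (comb y setT).
  (* [J] contains [J F(k) = F(k + e)] for one large [k]. *)
  have [N hN] := JF; pose k : 'rV[int]_s := const_mx N%:Z.
  apply: subset_trans (mF (k + e)) _; apply: radicalS; rewrite -hN -/J.
    by rewrite ideal_mul_comb // => _ [b Fb <-]; exists b.
  by move=> i; rewrite mxE.
have fJ : finite_length (V := R^o) setT (comb y setT).
  by apply: (finite_length_quotient noeth loc) mJ; exact: comb_ideal.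
have ym j : m (y j).
  have [[hm _ _] _] := loc.
  rewrite /y /yprod (bigD1 (Ordinal hs)) //=; apply: (idealMr hm).
  by case: (hI (Ordinal hs)) => _ <-; exists 1%N; rewrite expr1.
have yF k j u : F k u -> F (k + e) (y j * u).
  move=> Fu; rewrite addrC; apply: FM; apply: ideal_mulP => //.
  exact/IF/yprod_mpow.
have xrad t : (t < d)%N -> radical (comb y setT) xs`_t.
  by move=> td; apply/mJ/xm; rewrite /= mem_nth ?xsize.
pose H k : rat := (hilbert_fun F k)%:R.
pose p (k : 'rV[int]_s) : rat := P.@[fun i => (k 0 i)%:~R].
have -> : delta d (fun k => p k - H k) n = delta d p n - delta d H n.
  have := delta_diff d (fun k => p k - H k) n 0; rewrite addr0 => ->.
  rewrite iter_diffB; have := delta_diff d p n 0; have := delta_diff d H n 0.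
  by rewrite !addr0 => -> ->.
have JF' : for_large (fun k => ideal_mul (comb y setT) (F k) = F (k + e)).
  by rewrite -JE.
rewrite /p (delta_hilbert_poly xreg xsize hd xrad Fid fF fJ _ JF' hP); last first.
  by move=> k j; exact: mF.
have -> : delta d H n = \sum_(i < d.+1) (-1) ^+ i * (length_quot_homology y F n i)%:R.
  rewrite -euler_characteristic //.
  have := delta_diff d H n 0; rewrite addr0 => ->.
  by rewrite iter_diff_binomial; apply: eq_bigr.
have acyc z : koszul_deg 1 z -> koszul_diff y z = 0 ->
    exists2 w, koszul_deg 2 w & koszul_diff y w = z.
  exact: (koszul_acyclic xreg xsize xrad).
have low := length_low_homology Fid yF fF n acyc hd fJ.
rewrite -(big_mkord predT (fun i => (-1) ^+ i * (length_quot_homology y F n i)%:R)).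
rewrite 2?big_ltn // expr0 expr1 mul1r mulN1r addrA low ideal_mul_comb //.
by ring.
Qed.
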